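(* Let $m_2,m_3\in\mathbb{N}$. The following two assertions are equivalent. (1) For any centered Gaussian random vector $(X_1,X_2,X_3)$, $$E[X_1^{2}X_2^{2m_2}X_3^{2m_3}]\ge E[X_1^{2}]\,E[X_2^{2m_2}]\,E[X_3^{2m_3}],$$ and equality holds if and only if $X_1,X_2,X_3$ are independent. (2) For any bivariate (jointly) Gaussian random variables $(U,V)$ with $U\sim N(0,1)$ and $V\sim N(0,1)$, $$\begin{aligned} &\left(E[U^{2m_2+1}V^{2m_3+1}]\right)^2+(2m_2-1)!!(2m_3-1)!!\left\{E[U^{2m_2}V^{2m_3+2}]+E[V^{2m_2+2}U^{2m_3}]\right\}\\ &\le E[U^{2m_2}V^{2m_3+2}]\,E[V^{2m_2+2}U^{2m_3}]\\ &\quad+(2m_2-1)!!(2m_3-1)!!\left\{2E[U^{2m_2+1}V^{2m_3+1}]\,E[UV]+(2m_2-1)!!(2m_3-1)!!\left(1-(E[UV])^2\right)\right\}, \end{aligned}$$ and equality holds if and only if $|E[UV]|=1$.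
   Context: $\mathbb{N}=\{1,2,3,\dots\}$. A centered Gaussian random vector is a jointly Gaussian vector with mean zero; its covariance matrix may be singular. Standing assumption: every Gaussian random variable is real-valued and non-zero, i.e. each component of a Gaussian random vector has strictly positive variance. For $m\in\mathbb{N}$, $(2m-1)!!=1\cdot3\cdots(2m-1)$. *)

(* Defs.v *)
From HB Require Import structures.
From mathcomp Require Import all_boot all_order all_algebra.
From mathcomp Require Import all_classical all_reals all_analysis.

Set Implicit Arguments.
Unset Strict Implicit.
Unset Printing Implicit Defensive.

Import Order.TTheory GRing.Theory Num.Theory.

Local Open Scope classical_set_scope.
Local Open Scope ring_scope.

(* (2m - 1)!! = 1 * 3 * ... * (2m - 1) *)
Definition odd_dfact (m : nat) : nat := (\prod_(k < m) (2 * k + 1))%N.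

Section gaussian.
Context {d : measure_display} {T : measurableType d} {R : realType}.
Variable P : probability T R.

(* Only measurable sets are tested: measures are total functions on sets, with
   no meaning on non-measurable ones. *)
Definition has_law (X : T -> R) (mu : set R -> \bar R) : Prop :=
  forall A : set R, measurable A -> pushforward P X A = mu A.

(* [X ~ N(m, s ^+ 2)]. The case s = 0 is split off because the library's
   [normal_prob m 0] is the uniform law on `[0, 1], not the Dirac mass at m. *)
Definition is_normal (m s : R) (X : T -> R) : Prop :=
  has_law X (if s == 0 then \d_m : set R -> \bar R else normal_prob m s).

(* Every linear combination is normal, possibly degenerate; in particular the
   covariance matrix may be singular. *)
Definition jointly_gaussian n (X : n.-tuple {RV P >-> R}) : Prop :=
  forall c : 'I_n -> R, exists m s : R,
    0 <= s /\ is_normal m s (fun w => \sum_(i < n) c i * tnth X i w).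

(* Centered Gaussian vector all of whose components are non-zero, i.e. have
   positive variance. *)
Definition centered_gaussian n (X : n.-tuple {RV P >-> R}) : Prop :=
  [/\ jointly_gaussian X,
      forall i, 'E_P[tnth X i]%E = 0%E
    & forall i, (0 < 'V_P[tnth X i])%E].

(* Mutual independence: the product rule holds for every subfamily J. *)
Definition mutually_independent n (X : n.-tuple {RV P >-> R}) : Prop :=
  forall (J : {set 'I_n}) (A : 'I_n -> set R),
    (forall i, measurable (A i)) ->
    P (\bigcap_(i in [set` J]) (tnth X i @^-1` A i)) =
    (\prod_(i in J) P (tnth X i @^-1` A i))%E.

End gaussian.

(* Main.v *)
(* Write D = (2 m2 - 1)!! (2 m3 - 1)!!, let (U, V) be a standard pair with
   correlation r, and put A = E[U^(2 m2 + 2) V^(2 m3)] - D,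
   B = E[U^(2 m2 + 1) V^(2 m3 + 1)] - r D, C = E[U^(2 m2) V^(2 m3 + 2)] - D.
   Assertion (2) says that B^2 <= A C, with equality iff |r| = 1. In (1),
     rescale
   X2, X3 to U, V and write X1 = a U + b V + Z with Z uncorrelated with U and V:
   the two sides differ, up to a positive factor, by
     A a^2 + 2 B a b + C b^2 + E[Z^2] (E[U^(2 m2) V^(2 m3)] - D),
   where A > 0 and the last factor is nonnegative, and zero iff r = 0. So (2)
   gives (1), and (1) applied to all X1 = a U + b V gives (2).

   All joint moments are read off from univariate ones: they are, up to binomial
   factors, the coefficients in s of E[(s U + V)^n], hence of a power of a
   quadratic polynomial in s. The equality case of (1) needs that uncorrelated
   components are independent. Products of cosines have factorizing
     expectations,
   and replacing one cosine at a time by an indicator, a bounded limit of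
   trigonometric polynomials, yields the product rule. *)

Require Import Defs.
From HB Require Import structures.
From mathcomp Require Import all_boot all_order all_algebra.
From mathcomp Require Import all_classical all_reals all_analysis.
From mathcomp Require Import measurable_realfun.
From mathcomp Require Import ring lra zify.

Set Implicit Arguments.
Unset Strict Implicit.
Unset Printing Implicit Defensive.

Import Order.TTheory GRing.Theory Num.Theory.
Import numFieldNormedType.Exports.

Local Open Scope classical_set_scope.
Local Open Scope ring_scope.

(** * The normal law *)

(** Neither direction constructs a Gaussian vector: a pair yields the triples (a U + b V, U, V) on
    its own probability space, and a triple yields its rescaled last two components. The former
    triples always have a singular covariance matrix, so degenerate laws are unavoidable and the
    moment formulas for normal variables must include [s = 0].

    The delicate point is |r| = 1. There B^2 = A C holds automatically and the quadratic form is
    degenerate, so equality in (1) is excluded by another route: the form is a positive multiple of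
    the variance of a U + b V, the factor E[U^(2 m2) V^(2 m3)] - D is positive because r is nonzero,
    and together they would force X1 to have variance zero. For |r| < 1, equality in (1) at a
    nonzero X1 = a U + b V would make X1 uncorrelated with the variables that span it, which is
    absurd; hence the form is positive definite.

    Moments involving Z are found without conditioning: for each s, (Z, s U + V) is an uncorrelated
    Gaussian pair, and coefficients of powers of s are compared. The cosines carry a phase, so that
    sines, products and shifts of the variable stay in the same class. *)

Section normal_integral.
Context {R : realType}.
Implicit Types (m s t x : R).
Local Notation mu := (@lebesgue_measure R).

Import HBNNSimple.

(** [normal_prob] is given on sets, as the integral of the density; monotone convergence along
    simple functions, on both sides, carries this over to integrands. *)
Lemma ge0_integral_normal_prob m s (f : measurableTypeR R -> \bar R) :
  measurable_fun setT f -> (forall x, 0 <= f x)%E ->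
  (\int[normal_prob m s]_x f x = \int[mu]_x (f x * (normal_pdf m s x)%:E))%E.
Proof.
move=> mf f0; pose f_ := nnsfun_approx measurableT mf.
have pdf0 x : (0 <= (normal_pdf m s x)%:E)%E by rewrite lee_fin normal_pdf_ge0.
have mpdf : measurable_fun setT (fun x => (normal_pdf m s x)%:E).
  apply/measurable_EFinP; exact: measurable_normal_pdf.
have fE x : EFin (f_ n x) @[n --> \oo] --> f x.
  exact: cvg_nnsfun_approx.
transitivity (limn (fun n => \int[normal_prob m s]_x (f_ n x)%:E))%E.
  rewrite -monotone_convergence//.
  - by apply: eq_integral => y _; apply/esym/cvg_lim.
  - by move=> n; exact/measurable_EFinP/measurable_funP.
  - by move=> n y _; rewrite lee_fin.
  - by move=> y _ a b ab; rewrite lee_fin; exact/lefP/nd_nnsfun_approx.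
transitivity (limn (fun n =>
    \int[mu]_x ((f_ n x)%:E * (normal_pdf m s x)%:E)))%E; last first.
  rewrite -monotone_convergence//.
  - apply: eq_integral => y _; apply/cvg_lim => //.
    by apply: cvgeZr.
  - by move=> n; apply: emeasurable_funM => //;
      exact/measurable_EFinP/measurable_funP.
  - by move=> n y _; rewrite mule_ge0// lee_fin.
  - move=> y _ a b ab; apply: lee_wpmul2r => //.
    by rewrite lee_fin; exact/lefP/nd_nnsfun_approx.
congr (limn _); apply/funext => n.
under eq_integral do rewrite fimfunE -fsumEFin//.
rewrite ge0_integral_fsum//; last 2 first.
- by move=> y; exact/measurable_EFinP/measurable_funM.
- by move=> y x _; rewrite nnfun_muleindic_ge0.
transitivity (\sum_(k \in range (f_ n)) \int[mu]_x
   ((k * \1_(f_ n @^-1` [set k]) x)%:E * (normal_pdf m s x)%:E))%E.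
  apply: eq_fsbigr => r _; rewrite integralZl_indic_nnsfun// integral_indic//.
  rewrite setIT.
  (* A negative [r] is not a value of the nonnegative simple function, so its preimage is empty. *)
  have [r0|r0] := ltP r 0.
    rewrite preimage_nnfun0// measure0 mule0 integral0_eq// => x _.
    by rewrite indic0 mulr0 mul0e.
  under [RHS]eq_integral do rewrite EFinM -muleA.
  rewrite ge0_integralZl//.
  - congr (_ * _)%E.
    by rewrite /= /normal_prob integral_mkcond; apply: eq_integral => x _;
      rewrite epatch_indic muleC.
  - apply: emeasurable_funM => //.
    by apply/measurable_EFinP/measurable_indic/measurable_funPTI.
  - by move=> x _; rewrite mule_ge0// lee_fin.
rewrite -ge0_integral_fsum//.
- apply: eq_integral => x _.
  rewrite -ge0_mule_fsuml; first by rewrite fsumEFin// -fimfunE.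
  by move=> k; rewrite nnfun_muleindic_ge0.
- move=> r; apply: emeasurable_funM => //.
  by exact/measurable_EFinP/measurable_funM.
- by move=> r x _; rewrite mule_ge0// nnfun_muleindic_ge0.
Qed.

(** Completing the square: exponential tilting by [t] shifts the mean by [t * s ^+ 2]. *)
Lemma expR_normal_pdf m s t x : s != 0 ->
  expR (t * x) * normal_pdf m s x =
  expR (t * m + t ^+ 2 * s ^+ 2 / 2) * normal_pdf (m + t * s ^+ 2) s x.
Proof.
move=> s0; rewrite !normal_pdfE//.
rewrite mulrCA [RHS]mulrCA -!expRD; congr (_ * expR _).
by field.
Qed.

Lemma integral_expR_normal_prob m s t : s != 0 ->
  (\int[normal_prob m s]_x (expR (t * x))%:E
   = (expR (t * m + t ^+ 2 * s ^+ 2 / 2))%:E)%E.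
Proof.
move=> s0; rewrite ge0_integral_normal_prob//; last first.
  have : measurable_fun [set: R] (fun x : R => expR (t * x)).
    by apply: measurableT_comp => //; exact: measurable_funM.
  by move=> mexp; apply/measurable_EFinP.
under eq_integral do rewrite -EFinM expR_normal_pdf// EFinM.
rewrite integralZl//; last exact: integrable_normal_pdf.
by rewrite integral_normal_pdf mule1.
Qed.

End normal_integral.

Lemma integrable_EFinZl d (T : measurableType d) (R : realType)
    (mu : {measure set T -> \bar R}) (c : R) (f : T -> R) :
  mu.-integrable setT (EFin \o f) ->
  mu.-integrable setT (EFin \o (fun x => c * f x)).
Proof. by move=> fi; exact: (integrableZl measurableT c fi). Qed.

(** * Central moments of the normal law *)

Section normal_moments.
Context {R : realType}.
Implicit Types (m s t x : R).
Local Notation mu := (@lebesgue_measure R).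

(* A total derivative integrates to zero; with F the density times (y - m) ^+ n
   this gives the recursion for the central moments. *)
Lemma integral_derive_eq0 (F f : R -> R) m :
  (forall x, is_derive x 1 F (f x)) -> continuous f ->
  mu.-integrable setT (EFin \o f) ->
  F (m + k%:R) @[k --> \oo] --> 0 -> F (m - k%:R) @[k --> \oo] --> 0 ->
  \int[mu]_x f x = 0.
Proof.
move=> dF cf fi F0 F0'.
(* The endpoints use [k.+1] because the fundamental theorem of calculus asks for a nondegenerate
   interval. *)
pose I (k : nat) := `[m - k.+1%:R, m + k.+1%:R]%classic.
have FTC k : (\int[mu]_(x in I k) (f x)%:E)%E =
    (F (m + k.+1%:R) - F (m - k.+1%:R))%:E.
  have dF' x : derivable F x 1 by have [] := dF x.
  have cF : continuous F.
    by move=> x; apply: differentiable_continuous; exact/derivable1_diffP.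
  apply: continuous_FTC2.
  - rewrite ltrD2l -subr_gt0 opprK; by rewrite addr_gt0// ltr0n.
  - by apply: continuous_subspaceT.
  - split => //.
    + by apply: cvg_at_right_filter; exact: cF.
    + by apply: cvg_at_left_filter; exact: cF.
  - by move=> x _; rewrite derive1E; have [] := dF x.
have lim1 : (\int[mu]_(x in I k) (f x)%:E)%E @[k --> \oo] -->
    (\int[mu]_x (f x)%:E)%E.
  under eq_fun do rewrite integral_mkcond.
  have [] // := @dominated_convergence _ _ _ mu setT measurableT
     (fun k => ((EFin \o f) \_ (I k))) (EFin \o f) (fun x => `|(f x)%:E|%E).
  - move=> k; apply/(measurable_restrictT _ _).1 => //.
      exact: measurable_itv.
    exact: measurable_funTS (measurable_int _ fi).
  - exact: (measurable_int _ fi).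
  - apply: aeW => x _; apply: cvg_near_cst.
    near=> k; rewrite patchE mem_set// /I /= in_itv/= -ler_distlC.
    near: k; exists (Num.truncn `|m - x|) => // k /= mxk.
    by rewrite ltW// (lt_le_trans (truncnS_gt _))// ler_nat ltnS.
  - exact: integrable_abse.
  - apply: aeW => x k _; rewrite patchE; case: ifPn => //= _.
    by rewrite normr0 lee_fin normr_ge0.
have lim2 : (\int[mu]_(x in I k) (f x)%:E)%E @[k --> \oo] --> 0%:E.
  under eq_fun do rewrite FTC.
  apply: cvg_EFin; first by near=> k.
  rewrite (_ : 0 = 0 - 0); last by rewrite subr0.
  by apply: cvgB; rewrite (cvg_shiftS (fun k => F (_ _))).
rewrite /Rintegral.
by rewrite (cvg_unique _ lim1 lim2).
Unshelve. all: by end_near. Qed.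

(** Product rule, the density contributing the factor [- (x - m) / s ^+ 2]. At [n = 0] the truncated
    exponent [n.-1] is harmless, being multiplied by 0. *)
Lemma is_derive_normal_pdf m s n x : s != 0 ->
  is_derive x 1 (fun y => (y - m) ^+ n * normal_pdf m s y)
    (n%:R * ((x - m) ^+ n.-1 * normal_pdf m s x)
     - (s ^+ 2)^-1 * ((x - m) ^+ n.+1 * normal_pdf m s x)).
Proof.
move=> s0; rewrite normal_pdfE//.
pose u : R -> R := id - cst m.
have du : is_derive x 1 u 1.
  by apply: is_derive_eq; rewrite subr0.
pose c := - (s ^+ 2 *+ 2)^-1.
have dg : is_derive x 1 (normal_peak s \*: (expR \o (c \*: u ^+ 2)))
    (normal_peak s *: (expR ((c \*: u ^+ 2) x) * (c *: ((2 * u x ^+ 1) *: 1)))).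
  exact: is_deriveZ.
rewrite (_ : (fun y => _) = u ^+ n *
    (normal_peak s \*: (expR \o (c \*: u ^+ 2)))); last first.
  apply/funext => y; rewrite /normal_fun /u /c !fctE /=.
  congr (_ * (_ * expR _)); rewrite /GRing.scale/=.
  by rewrite !mulNr mulrC.
apply: is_derive_eq.
have scaleE (a b : R) : a *: (b : R^o) = a * b by [].
have uX k : (u ^+ k) x = (x - m) ^+ k by rewrite exprfctE.
have gE : (normal_peak s \*: (expR \o (c \*: u ^+ 2))) x =
    normal_peak s * expR (c * (x - m) ^+ 2).
  by rewrite /= uX.
have -> : normal_fun m s x = expR (c * (x - m) ^+ 2).
  by rewrite /normal_fun /c !mulNr mulrC.
rewrite gE uX !scaleE /= uX scaleE (_ : u x = x - m)//.
by rewrite expr1 [(x - m) ^+ n.+1]exprSr /c; field.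
Qed.

(** Keep one term of the exponential series, y^(n+1) / (n+1)! <= e^y at y = k^2 / t. It contributes
    k^(-2n-2), which turns k^n into k^(-n-2) <= 1/k. *)
Lemma expn_expR_le n k t : (0 < k)%N -> 0 < t ->
  k%:R ^+ n * expR (- (k%:R ^+ 2 / t)) <= n.+1`!%:R * t ^+ n.+1 / k%:R :> R.
Proof.
move=> k0 t0; have k1 : 1 <= k%:R :> R by rewrite ler1n.
have kp : 0 < k%:R :> R by rewrite ltr0n.
have y0 : 0 < k%:R ^+ 2 / t by rewrite divr_gt0// exprn_gt0.
have fp : 0 < n.+1`!%:R :> R by rewrite ltr0n fact_gt0.
have h : (k%:R ^+ 2 / t) ^+ n.+1 / n.+1`!%:R <= expR (k%:R ^+ 2 / t).
  by apply: le_trans (expR_ge1Dxn n (ltW y0)); rewrite lerDr.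
have {}h : expR (- (k%:R ^+ 2 / t)) <= n.+1`!%:R * t ^+ n.+1 / k%:R ^+ n.+1.*2.
  have hp : 0 < (k%:R ^+ 2 / t) ^+ n.+1 / n.+1`!%:R by rewrite divr_gt0//
    exprn_gt0.
  apply: (@le_trans _ _ ((k%:R ^+ 2 / t) ^+ n.+1 / n.+1`!%:R)^-1).
    by rewrite expRN lef_pV2 ?posrE ?expR_gt0.
  by rewrite invf_div expr_div_n -exprM mul2n invf_div mulrA.
apply: (le_trans (ler_wpM2l _ h)); first by rewrite exprn_ge0// ltW.
rewrite mulrCA; apply: ler_wpM2l.
  by rewrite mulr_ge0// ?exprn_ge0// ltW.
rewrite ler_pdivrMr ?exprn_gt0// -addnn addSn exprS mulKf ?gt_eqF//.
by rewrite ler_weXn2l// leq_addr.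
Qed.

Lemma cvg_expn_expR_0 n t : 0 < t ->
  k%:R ^+ n * expR (- (k%:R ^+ 2 / t)) @[k --> \oo] --> (0 : R).
Proof.
move=> t0; apply: (@squeeze_cvgr _ _ _ _ (cst 0)
    (fun k => n.+1`!%:R * t ^+ n.+1 / k%:R)).
- near=> k; rewrite mulr_ge0 ?exprn_ge0 ?expR_ge0//=.
  by rewrite expn_expR_le//; near: k; exists 1%N.
- exact: cvg_cst.
- rewrite -[X in _ --> X](mulr0 (n.+1`!%:R * t ^+ n.+1)).
  apply: cvgMr; apply/cvgrVy.
    by near=> k; rewrite invr_gt0 ltr0n; near: k; exists 1%N.
  rewrite (_ : unstable.inv_fun _ = fun k => k%:R); first exact: cvgr_idn.
  by apply/funext => k; rewrite /unstable.inv_fun invrK.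
Unshelve. all: by end_near. Qed.

Lemma integrable_expR_normal_pdf m s t : s != 0 ->
  mu.-integrable setT (fun x => (expR (t * x) * normal_pdf m s x)%:E).
Proof.
move=> s0; under eq_fun do rewrite expR_normal_pdf// EFinM.
by apply: integrableZl => //; exact: integrable_normal_pdf.
Qed.

Lemma norm_expn_le_expR n x : `|x| ^+ n <= n`!%:R * (expR x + expR (- x)).
Proof.
have np : 0 < n`!%:R :> R by rewrite ltr0n fact_gt0.
rewrite mulrC -ler_pdivrMr//.
apply: (@le_trans _ _ (expR `|x|)).
  case: n np => [|n] np; first by rewrite expr0 divr1 -expR0 ler_expR.
  by apply: le_trans (expR_ge1Dxn n _) => //; rewrite lerDr.
by case: (ger0P x) => _; rewrite ?lerDl ?lerDr expR_ge0.
Qed.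

Lemma integrable_expn_normal_pdf m s n : s != 0 ->
  mu.-integrable setT (fun x => ((x - m) ^+ n * normal_pdf m s x)%:E).
Proof.
move=> s0; apply: (@le_integrable _ _ _ mu _ measurableT _ (fun x =>
   (n`!%:R * expR (- m) * (expR (1 * x) * normal_pdf m s x)
    + n`!%:R * expR m * (expR (-1 * x) * normal_pdf m s x))%:E)).
- have h : measurable_fun [set: R] (fun x : R => (x - m) ^+ n * normal_pdf m s
  x).
    apply: measurable_funM; last exact: measurable_normal_pdf.
    by apply: measurable_funX; exact: measurable_funB.
  by apply/measurable_EFinP.
- move=> x _ /=; rewrite lee_fin normrM [`|normal_pdf _ _ _|]ger0_norm
  ?normal_pdf_ge0//.
  rewrite [leRHS]ger0_norm; last first.
    by rewrite addr_ge0 ?mulr_ge0 ?expR_ge0 ?normal_pdf_ge0.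
  rewrite normrX.
  apply: (le_trans (ler_wpM2r (normal_pdf_ge0 _ _ _) (norm_expn_le_expR n (x -
    m)))).
  rewrite le_eqVlt; apply/orP; left; apply/eqP.
  by rewrite expRD opprB expRD mul1r mulN1r; ring.
- have h c t : mu.-integrable setT (fun x => (c * (expR (t * x) * normal_pdf m
  s x))%:E).
    by apply: integrable_EFinZl; exact: integrable_expR_normal_pdf.
  by apply: (integrableD _ (h _ _) (h _ _)).
Qed.

Local Notation M m s n := (\int[mu]_x ((x - m) ^+ n * normal_pdf m s x)).

Lemma normal_pdf_moment_rec m s n : s != 0 ->
  M m s n.+1 = n%:R * s ^+ 2 * M m s n.-1.
Proof.
move=> s0.
have i1 k := integrable_expn_normal_pdf m k s0.
have := @integral_derive_eq0 _ _ m (fun x => @is_derive_normal_pdf m s n x s0).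
have i2 c k := integrable_EFinZl c (i1 k).
rewrite (RintegralB measurableT (i2 n%:R n.-1) (i2 (s ^- 2) n.+1)).
rewrite (RintegralZl _ measurableT (i1 _)) (RintegralZl _ measurableT (i1 _)).
have ct k : continuous (fun x : R => (x - m) ^+ k).
  move=> x; apply: (@continuous_comp R R R (fun x => x - m) (fun y => y ^+ k)).
    by apply: cvgB; [exact: cvg_id|exact: cvg_cst].
  exact: (@exprn_continuous R k).
have cpdf k : continuous (fun x : R => (x - m) ^+ k * normal_pdf m s x).
  by move=> x; apply: cvgM; [exact: ct|exact: continuous_normal_pdf].
(* The sign [e] treats the two tails at once. *)
have pdfE k e : (e = 1 \/ e = -1) ->
    (m + e * k%:R - m) ^+ n * normal_pdf m s (m + e * k%:R) =
    e ^+ n * normal_peak s * (k%:R ^+ n * expR (- (k%:R ^+ 2 / (s ^+ 2 *+ 2)))).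
  move=> e1; rewrite normal_pdfE// /normal_fun addrAC subrr add0r.
  rewrite !exprMn (_ : e ^+ 2 = 1) ?mul1r ?mulNr; first by ring.
  by case: e1 => ->; rewrite ?sqrrN expr1n.
have lim e : (e = 1 \/ e = -1) ->
    (m + e * k%:R - m) ^+ n * normal_pdf m s (m + e * k%:R) @[k --> \oo] --> 0.
  move=> e1; rewrite (funext (fun k => pdfE k e e1)).
  rewrite -[X in _ --> X](mulr0 (e ^+ n * normal_peak s)).
  apply: cvgMr; apply: cvg_expn_expR_0.
  by rewrite mulrn_wgt0// exprn_even_gt0.
move=> h.
have {}h : n%:R * M m s n.-1 - s ^- 2 * M m s n.+1 = 0.
  apply: h.
  - by move=> x; apply: cvgB; apply: cvgMr; exact: cpdf.
  - exact: (integrableB measurableT (i2 n%:R n.-1) (i2 (s ^- 2) n.+1)).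
  - by have := lim 1 (or_introl erefl); under eq_fun do rewrite mul1r.
  - by have := lim (-1) (or_intror erefl); under eq_fun do rewrite mulN1r.
move/eqP: h; rewrite subr_eq0 => /eqP h.
by rewrite mulrAC h mulrC mulVKf// sqrf_eq0.
Qed.

End normal_moments.

(** * Variables with moments of all orders *)

Section moments.
Context {d : measure_display} {T : measurableType d} {R : realType}.
Variable P : probability T R.
Implicit Types X Y : T -> R.

(** Closed under sums, products and powers, so that every polynomial in Gaussian variables is
    integrable by a structural argument. *)
Definition has_moments X := measurable_fun setT X /\
  forall n, P.-integrable setT (EFin \o (fun w => `|X w| ^+ n)).

Lemma integrable_EFin_le X Y : measurable_fun setT X ->
  P.-integrable setT (EFin \o Y) -> (forall w, `|X w| <= Y w) ->
  P.-integrable setT (EFin \o X).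
Proof.
move=> mX iY XY; apply: (le_integrable measurableT _ _ iY).
  exact/measurable_EFinP.
by move=> w _; rewrite /= lee_fin (le_trans (XY w))// ler_norm.
Qed.

Lemma integrable_bounded X M : measurable_fun setT X ->
  (forall w, `|X w| <= M) -> P.-integrable setT (EFin \o X).
Proof.
move=> mX XM; apply: (@integrable_EFin_le _ (cst M)) => //.
exact: finite_measure_integrable_cst.
Qed.

Lemma measurable_cos_affine X t u : measurable_fun setT X ->
  measurable_fun setT (fun w => cos (t * X w + u)).
Proof.
move=> mX; have mc : measurable_fun [set: R] (@cos R).
  by apply: continuous_measurable_fun; exact: continuous_cos.
apply: (measurableT_comp mc); apply: measurable_funD => //.
exact: measurable_funM.
Qed.

Lemma has_momentsW X : has_moments X -> P.-integrable setT (EFin \o X).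
Proof.
by move=> [mX /(_ 1%N) iX]; apply: integrable_EFin_le iX _.
Qed.

Lemma has_moments_cst c : has_moments (fun=> c).
Proof.
split => // n; exact: (finite_measure_integrable_cst _ (`|c| ^+ n)).
Qed.

Lemma has_moments_bounded X M : measurable_fun setT X ->
  (forall w, `|X w| <= M) -> has_moments X.
Proof.
move=> mX XM; split => // n; apply: (@integrable_bounded _ (M ^+ n)) => [|w].
  by apply: measurable_funX; exact: measurableT_comp.
by rewrite normrX normr_id lerXn2r// nnegrE// (le_trans _ (XM w)).
Qed.

(** The bound is |X Y|^n <= |X|^(2n) + |Y|^(2n). *)
Lemma has_momentsM X Y : has_moments X -> has_moments Y ->
  has_moments (fun w => X w * Y w).
Proof.
move=> [mX iX] [mY iY]; split=> [|n]; first exact: measurable_funM.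
have h := integrableD measurableT (iX (n + n)%N) (iY (n + n)%N).
apply: (integrable_EFin_le _ h) => [|w /=].
  apply: measurable_funX; apply: measurableT_comp => //.
  exact: measurable_funM.
rewrite normrX normr_id normrM exprMn !exprD -!expr2.
set x := _ ^+ n; set y := _ ^+ n.
have := sqr_ge0 (x - y); have := sqr_ge0 x; have := sqr_ge0 y.
rewrite sqrrB; nra.
Qed.

(** The sum is at most twice the larger term, whence the constant [2 ^+ n]. *)
Lemma has_momentsD X Y : has_moments X -> has_moments Y ->
  has_moments (fun w => X w + Y w).
Proof.
move=> [mX iX] [mY iY]; split=> [|n]; first exact: measurable_funD.
have h := integrable_EFinZl (2 ^+ n)
  (integrableD measurableT (iX n) (iY n)).
apply: (integrable_EFin_le _ h) => [|w /=].
  apply: measurable_funX; apply: measurableT_comp => //.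
  exact: measurable_funD.
rewrite normrX normr_id.
have key (a b : R) : 0 <= a -> a <= b -> (a + b) ^+ n <= 2 ^+ n * (a ^+ n + b
  ^+ n).
  move=> a0 ab; have b0 := le_trans a0 ab.
  apply: (@le_trans _ _ ((2 * b) ^+ n)).
    by rewrite lerXn2r ?nnegrE ?addr_ge0 ?mulr_ge0// mulr2n mulrDl mul1r lerD2r.
  by rewrite exprMn ler_wpM2l ?exprn_ge0// lerDr exprn_ge0.
apply: (@le_trans _ _ ((`|X w| + `|Y w|) ^+ n)).
  by rewrite lerXn2r ?nnegrE ?addr_ge0// ler_normD.
have [XY|/ltW XY] := leP `|X w| `|Y w|; first exact: key.
by rewrite (addrC `|X w|) (addrC (`|X w| ^+ n)); exact: key.
Qed.

Lemma has_momentsX X n : has_moments X -> has_moments (fun w => X w ^+ n).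
Proof.
move=> hX; elim: n => [|n IHn]; first exact: has_moments_cst.
by under eq_fun do rewrite exprS; exact: has_momentsM.
Qed.

Lemma has_momentsZ c X : has_moments X -> has_moments (fun w => c * X w).
Proof. by apply: has_momentsM; exact: has_moments_cst. Qed.

Lemma has_momentsB X Y : has_moments X -> has_moments Y ->
  has_moments (fun w => X w - Y w).
Proof.
move=> hX hY; have := has_momentsD hX (has_momentsZ (-1) hY).
by under eq_fun do rewrite mulN1r.
Qed.

Lemma has_moments_sum n (F : 'I_n -> T -> R) : (forall i, has_moments (F i)) ->
  has_moments (fun w => \sum_(i < n) F i w).
Proof.
move=> hF; elim: n F hF => [|n IHn] F hF.
  by under eq_fun do rewrite big_ord0; exact: has_moments_cst.
by under eq_fun do rewrite big_ord_recr; apply: has_momentsD => //; exact: IHn.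
Qed.

(** The passage from extended-real expectations to real means, in which all computations are carried
    out. *)
Lemma expectation_mean X : has_moments X -> ('E_P[X])%E = (\int[P]_w X w)%:E.
Proof.
by move=> /has_momentsW iX; rewrite unlock /Rintegral fineK//
  integrable_fin_num.
Qed.

Lemma meanD X Y : has_moments X -> has_moments Y ->
  \int[P]_w (X w + Y w) = \int[P]_w X w + \int[P]_w Y w.
Proof. by move=> /has_momentsW iX /has_momentsW iY; rewrite RintegralD. Qed.

Lemma meanB X Y : has_moments X -> has_moments Y ->
  \int[P]_w (X w - Y w) = \int[P]_w X w - \int[P]_w Y w.
Proof. by move=> /has_momentsW iX /has_momentsW iY; rewrite RintegralB. Qed.

Lemma meanZ c X : has_moments X ->
  \int[P]_w (c * X w) = c * \int[P]_w X w.
Proof. by move=> /has_momentsW iX; rewrite RintegralZl. Qed.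

Lemma mean_cst c : \int[P]_w c = c.
Proof. by rewrite (Rintegral_cst P measurableT) /= probability_setT mulr1. Qed.

Lemma mean_sum n (F : 'I_n -> T -> R) : (forall i, has_moments (F i)) ->
  \int[P]_w (\sum_(i < n) F i w) = \sum_(i < n) \int[P]_w F i w.
Proof.
move=> hF; elim: n F hF => [|n IHn] F hF.
  by under eq_Rintegral do rewrite big_ord0; rewrite big_ord0 mean_cst.
under eq_Rintegral do rewrite big_ord_recr.
by rewrite /= meanD//; [rewrite IHn// big_ord_recr|exact: has_moments_sum].
Qed.

Lemma has_moments_expR X : measurable_fun setT X ->
  P.-integrable setT (EFin \o (fun w => expR (X w))) ->
  P.-integrable setT (EFin \o (fun w => expR (- X w))) -> has_moments X.
Proof.
move=> mX i1 i2; split => // n.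
have h := integrable_EFinZl n`!%:R (integrableD measurableT i1 i2).
apply: (integrable_EFin_le _ h) => [|w /=].
  by apply: measurable_funX; exact: measurableT_comp.
by rewrite normrX normr_id norm_expn_le_expR.
Qed.

End moments.

(** * Normal random variables *)

Section normal_variable.
Context {d : measure_display} {T : measurableType d} {R : realType}.
Variable P : probability T R.
Local Notation mu := (@lebesgue_measure R).
Implicit Types (X : T -> R) (m s : R).

Lemma ge0_integral_is_normal m s X (f : R -> \bar R) :
  measurable_fun setT X -> is_normal P m s X -> s != 0 ->
  measurable_fun [set: R] f -> (forall x, 0 <= f x)%E ->
  (\int[P]_w f (X w) = \int[mu]_x (f x * (normal_pdf m s x)%:E))%E.
Proof.
move=> mX nX s0 mf f0; rewrite -ge0_integral_normal_prob//.
(* [normal_prob] is a measure on [measurableTypeR R], so the variable is retyped before the change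
   of variables. *)
pose Y : T -> measurableTypeR R := X.
have mY : measurable_fun setT Y by [].
pose X' : {RV P >-> measurableTypeR R} :=
  HB.pack Y (isMeasurableFun.Build _ _ _ _ Y mY).
have mf' : @measurable_fun _ _ (measurableTypeR R) (\bar R) setT f by [].
rewrite -[LHS](@ge0_integral_distribution _ _ _ _ _ _ X' f mf' f0).
apply: (@eq_measure_integral _ (measurableTypeR R) _ _ (normal_prob m s)
  (distribution P X')) => A mA _.
by have := nX A mA; rewrite (negbTE s0).
Qed.

(** Both integrals are differences of the integrals of positive and negative parts, and
    multiplication by a nonnegative density commutes with taking parts. *)
Lemma integral_is_normal m s X (f : R -> \bar R) :
  measurable_fun setT X -> is_normal P m s X -> s != 0 ->
  measurable_fun [set: R] f ->
  (\int[P]_w f (X w) = \int[mu]_x (f x * (normal_pdf m s x)%:E))%E.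
Proof.
move=> mX nX s0 mf; rewrite [LHS]integralE [RHS]integralE.
have pdf0 x : (0 <= (normal_pdf m s x)%:E)%E by rewrite lee_fin normal_pdf_ge0.
have mp : measurable_fun [set: R] (f^\+)%E by exact: measurable_funepos.
have mn : measurable_fun [set: R] (f^\-)%E by exact: measurable_funeneg.
congr (_ - _)%E.
- transitivity (\int[P]_w (f^\+ (X w)))%E; first by apply: eq_integral => w _;
  rewrite ?funeposE ?funenegE.
  rewrite (ge0_integral_is_normal mX nX s0 mp)//.
  apply: eq_integral => x _.
  by rewrite !funeposE muleC [in RHS]muleC maxe_pMr// mule0.
- transitivity (\int[P]_w (f^\- (X w)))%E; first by apply: eq_integral => w _;
  rewrite ?funeposE ?funenegE.
  rewrite (ge0_integral_is_normal mX nX s0 mn)//.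
  apply: eq_integral => x _.
  by rewrite !funenegE muleC [in RHS]muleC -muleN maxe_pMr// mule0.
Qed.

(** The Dirac law gives mass 0 to the complement of [m]. Such laws do arise: a linear combination of
    the components of a singular vector may vanish almost surely. *)
Lemma is_normal0_ae m X : measurable_fun setT X -> is_normal P m 0 X ->
  {ae P, forall w, X w = m}.
Proof.
move=> mX nX; exists (X @^-1` (~` [set m])); split.
- by rewrite -[X in measurable X]setTI; apply: mX => //; exact: measurableC.
- have /= := nX (~` [set m]); rewrite eqxx /pushforward => ->; last exact:
  measurableC.
  by rewrite diracE memNset//=; exact.
- by move=> w /= h; apply: contra_not h.
Qed.

Lemma integral_is_normal0 m X (f : R -> \bar R) :
  measurable_fun setT X -> is_normal P m 0 X ->
  measurable_fun [set: R] f ->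
  (\int[P]_w f (X w) = f m)%E.
Proof.
move=> mX nX mf.
rewrite (ae_eq_integral (cst (f m)))//=.
- by rewrite integral_cst//= probability_setT mule1.
- exact: measurableT_comp.
- have [N [mN PN h]] := is_normal0_ae mX nX; exists N; split => // w /= nw.
  by apply: h => /= e; apply: nw => _; rewrite e.
Qed.

Lemma integrable_expR_is_normal m s X t : measurable_fun setT X ->
  is_normal P m s X -> P.-integrable setT (EFin \o (fun w => expR (t * X w))).
Proof.
move=> mX nX; have mexp : measurable_fun [set: R] (fun x : R => expR (t * x)).
  by apply: measurableT_comp => //; exact: measurable_funM.
have mE : measurable_fun [set: R] (fun x : R => (expR (t * x))%:E).
  exact/measurable_EFinP.
apply/integrableP; split.
  by apply/measurable_EFinP; exact: (measurableT_comp mexp mX).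
under eq_integral do rewrite /= ger0_norm ?expR_ge0//.
have [s0|s0] := eqVneq s 0.
  rewrite s0 in nX.
  by rewrite (integral_is_normal0 mX nX mE) ltry.
rewrite (ge0_integral_is_normal mX nX s0 mE).
  rewrite -ge0_integral_normal_prob//; first by rewrite
    integral_expR_normal_prob// ltry.
by move=> x; rewrite lee_fin expR_ge0.
Qed.

Lemma is_normal_has_moments m s X : measurable_fun setT X ->
  is_normal P m s X -> has_moments P X.
Proof.
move=> mX nX; apply: has_moments_expR => //.
- by have := integrable_expR_is_normal 1 mX nX; under eq_fun do rewrite mul1r.
- by have := integrable_expR_is_normal (-1) mX nX; under eq_fun do rewrite
  mulN1r.
Qed.

Lemma is_normal_moment_rec m s X n : measurable_fun setT X ->
  is_normal P m s X ->
  \int[P]_w (X w - m) ^+ n.+1 = n%:R * s ^+ 2 * \int[P]_w (X w - m) ^+ n.-1.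
Proof.
move=> mX nX; rewrite /Rintegral.
have mf k : measurable_fun [set: R] (fun x : R => ((x - m) ^+ k)%:E).
  by apply/measurable_EFinP/measurable_funX; exact: measurable_funB.
have [s0|s0] := eqVneq s 0.
  rewrite s0 in nX *; rewrite !(integral_is_normal0 mX nX (mf _)).
  by rewrite subrr expr0n/= expr0n/= mulr0 mul0r.
rewrite !(integral_is_normal mX nX s0 (mf _)).
exact: normal_pdf_moment_rec.
Qed.

(** The moment recursion at [n = 0] says that [X - m] has mean 0. *)
Lemma is_normal_mean m s X : measurable_fun setT X ->
  is_normal P m s X -> \int[P]_w X w = m.
Proof.
move=> mX nX; have hX := is_normal_has_moments mX nX.
have := is_normal_moment_rec 0 mX nX; rewrite !mul0r.
under eq_Rintegral do rewrite expr1.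
rewrite meanB//; last exact: has_moments_cst.
by rewrite mean_cst => /eqP; rewrite subr_eq0 => /eqP.
Qed.

(** The [n]-th moment of the centered normal law of variance [v]; for even [n], [odd_dfact n./2] is
    (n - 1)!!. *)
Definition gaussian_moment (n : nat) (v : R) : R :=
  if odd n then 0 else (odd_dfact n./2)%:R * v ^+ n./2.

Lemma odd_dfactS n : odd_dfact n.+1 = (odd_dfact n * (2 * n + 1))%N.
Proof. by rewrite /odd_dfact big_ord_recr. Qed.

Lemma gaussian_moment_rec n v :
  gaussian_moment n.+2 v = n.+1%:R * v * gaussian_moment n v.
Proof.
rewrite /gaussian_moment /= negbK; case: ifP => [_|on]; first by rewrite mulr0.
rewrite odd_dfactS natrM exprS.
have -> : (2 * n./2 + 1 = n.+1)%N.
  by rewrite -[in RHS](odd_double_half n) on add0n mul2n addn1.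
ring.
Qed.

Lemma is_normal0_moment s X n : measurable_fun setT X ->
  is_normal P 0 s X -> \int[P]_w X w ^+ n = gaussian_moment n (s ^+ 2).
Proof.
move=> mX nX.
have rec k := is_normal_moment_rec k mX nX.
have {}rec k : \int[P]_w X w ^+ k.+1 = k%:R * s ^+ 2 * \int[P]_w X w ^+ k.-1.
  have := rec k; under eq_Rintegral do rewrite subr0.
  by under [in RHS]eq_Rintegral do rewrite subr0.
elim/ltn_ind: n => -[|[|n]] IHn.
- under eq_Rintegral do rewrite expr0.
  by rewrite mean_cst /gaussian_moment /odd_dfact/= big_ord0 mul1r.
- by rewrite rec !mul0r.
- by rewrite rec IHn// gaussian_moment_rec.
Qed.

End normal_variable.

(** * Means of cosine and sine of a normal variable *)

Section characteristic_function.
Context {d : measure_display} {T : measurableType d} {R : realType}.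
Variable P : probability T R.
Implicit Types (X : T -> R) (s : R).

Lemma cvg_mean_dominated (f_ : nat -> T -> R) (f g : T -> R) :
  (forall n, measurable_fun setT (f_ n)) -> measurable_fun setT f ->
  P.-integrable setT (EFin \o g) ->
  (forall n w, `|f_ n w| <= g w) ->
  (forall w, f_ n w @[n --> \oo] --> f w) ->
  \int[P]_w f_ n w @[n --> \oo] --> \int[P]_w f w.
Proof.
move=> mf_ mf ig fg f_f.
have h1 : {ae P, forall w, setT w -> (EFin \o f_ n) w @[n --> \oo] --> (EFin \o
  f) w}.
  by apply: aeW => w _; apply: cvg_EFin; [near=> n|exact: f_f].
have h2 : {ae P, forall w n, setT w -> (`|(EFin \o f_ n) w| <= (EFin \o g)
  w)%E}.
  by apply: aeW => w n _; rewrite lee_fin.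
have [fi _ h] := dominated_convergence measurableT
  (fun n => (measurable_EFinP _ _).2 (mf_ n)) ((measurable_EFinP _ _).2 mf) h1
    ig h2.
apply: fine_cvg; rewrite fineK; first exact: h.
exact: integrable_fin_num.
Unshelve. all: by end_near. Qed.

Lemma norm_series_le_expR (c : nat -> R) (x : R) n :
  (forall k, `|c k| <= exp_coeff `|x| k) -> `|series c n| <= expR `|x|.
Proof.
move=> cx; apply: (le_trans (ler_norm_sum _ _ _)).
apply: (@le_trans _ _ (series (exp_coeff `|x|) n)); first exact: ler_sum.
apply: nondecreasing_cvgn_le; last exact: is_cvg_series_exp_coeff.
by apply: nondecreasing_series => k _ _; rewrite exp_coeff_ge0.
Qed.

Lemma norm_cos_coeff_le (x : R) k : `|cos_coeff x k| <= exp_coeff `|x| k.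
Proof.
rewrite /exp_coeff /cos_coeff /= !normrM normfV !normr_nat !normrX normrN
  normr1 expr1n mulr1.
by case: odd; rewrite ?mul1r// !mul0r divr_ge0.
Qed.

Lemma norm_sin_coeff_le (x : R) k : `|sin_coeff x k| <= exp_coeff `|x| k.
Proof.
rewrite /exp_coeff /sin_coeff /= !normrM normfV !normr_nat !normrX normrN
  normr1 expr1n mulr1.
by case: odd; rewrite ?mul1r// !mul0r divr_ge0.
Qed.

(* Exponential moments dominate the partial sums, so the power series may be
   integrated term by term. *)
Lemma is_normal_cvg_mean_series s X (a : nat -> R) (F : R -> R) :
  measurable_fun setT X -> is_normal P 0 s X ->
  measurable_fun [set: R] F ->
  (forall x k, `|a k * x ^+ k| <= exp_coeff `|x| k) ->
  (forall x, series (fun k => a k * x ^+ k) n @[n --> \oo] --> F x) ->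
  series (fun k => a k * gaussian_moment k (s ^+ 2)) n @[n --> \oo]
    --> \int[P]_w F (X w).
Proof.
move=> mX nX mF ale aF; have hX := is_normal_has_moments mX nX.
have hs n : has_moments P (fun w => series (fun k => a k * X w ^+ k) n).
  rewrite /series /=; under eq_fun do rewrite big_mkord.
  by apply: has_moments_sum => i; apply: has_momentsZ; exact: has_momentsX.
have -> : series (fun k => a k * gaussian_moment k (s ^+ 2)) =
    fun n => \int[P]_w (series (fun k => a k * X w ^+ k) n).
  apply/funext => n; rewrite /series /= big_mkord.
  under [RHS]eq_Rintegral do rewrite big_mkord.
  rewrite mean_sum; last first.
    by move=> i; apply: has_momentsZ; exact: has_momentsX.
  apply: eq_bigr => i _; rewrite meanZ; last exact: has_momentsX.
  by rewrite (is_normal0_moment i mX nX).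
have i1 := integrable_expR_is_normal 1 mX nX.
have i2 := integrable_expR_is_normal (-1) mX nX.
apply: (cvg_mean_dominated _ _ (integrableD measurableT i1 i2)).
- by move=> n; have [] := hs n.
- exact: measurableT_comp.
- move=> n w /=; apply: (le_trans (norm_series_le_expR _ _)); first exact: ale.
  rewrite mul1r mulN1r.
  by case: (ger0P (X w)) => _; rewrite ?lerDl ?lerDr expR_ge0.
- by move=> w; exact: aF.
Qed.

Lemma fact_double n : (n.*2)`! = (odd_dfact n * 2 ^ n * n`!)%N.
Proof.
elim: n => [|n IHn]; first by rewrite /odd_dfact big_ord0.
rewrite doubleS !factS IHn odd_dfactS expnS; lia.
Qed.

(** By (2n)! = (2n-1)!! 2^n n!, the double factorial of the moment cancels, and the cosine term of
    order 2n has mean (- s^2 / 2)^n / n!. *)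
Lemma is_normal_mean_cos s X : measurable_fun setT X -> is_normal P 0 s X ->
  \int[P]_w cos (X w) = expR (- (s ^+ 2 / 2)).
Proof.
move=> mX nX.
pose a k : R := (~~ odd k)%:R * (-1) ^+ k./2 * k`!%:R^-1.
have aE x : (fun k => a k * x ^+ k) = cos_coeff x.
  by apply/funext => k; rewrite /cos_coeff /a mulrAC.
have h : series (fun k => a k * gaussian_moment k (s ^+ 2)) n @[n --> \oo]
    --> \int[P]_w cos (X w).
  apply: (is_normal_cvg_mean_series mX nX).
  - by apply: continuous_measurable_fun; exact: continuous_cos.
  - by move=> x k; have := norm_cos_coeff_le x k; rewrite -aE.
  - by move=> x; rewrite aE unlock; exact: is_cvg_series_cos_coeff.
(* Odd terms vanish, so the even partial sums are exactly the partial sums of the exponential series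
   at [- (s ^+ 2 / 2)]. *)
have h2 : series (fun k => a k * gaussian_moment k (s ^+ 2)) n.*2 @[n --> \oo]
    --> \int[P]_w cos (X w).
  apply: (cvg_comp _ _ _ h); move=> A [N _ NA]; exists N => // n /= Nn.
  by apply: NA => /=; rewrite (leq_trans Nn)// -addnn leq_addr.
have h3 : series (fun k => a k * gaussian_moment k (s ^+ 2)) n.*2 @[n --> \oo]
    --> expR (- (s ^+ 2 / 2)).
  have -> : (fun n => series (fun k => a k * gaussian_moment k (s ^+ 2)) n.*2) =
      series (exp_coeff (- (s ^+ 2 / 2))).
    apply/funext; elim => [|n IHn]; first by rewrite /series /= !big_geq.
    rewrite doubleS /series /= !big_nat_recr//= -/(series _ _) [LHS]addrAC.
    have -> : a n.*2.+1 = 0 by rewrite /a /= odd_double /= !mul0r.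
    rewrite mul0r addr0; congr (_ + _); first exact: IHn.
    rewrite /a /gaussian_moment odd_double doubleK mul1r fact_double.
    rewrite /exp_coeff /= !natrM natrX (exprNn (s ^+ 2 / 2)) expr_div_n.
    have f1 : n`!%:R != 0 :> R by rewrite pnatr_eq0 -lt0n fact_gt0.
    have f2 : (odd_dfact n)%:R != 0 :> R.
      by rewrite pnatr_eq0 -lt0n prodn_gt0// => i; rewrite addn1.
    by field; rewrite f1 f2 expf_neq0.
  exact: is_cvg_series_exp_coeff.
exact: (cvg_unique _ h2 h3).
Qed.

Lemma is_normal_mean_sin s X : measurable_fun setT X -> is_normal P 0 s X ->
  \int[P]_w sin (X w) = 0.
Proof.
move=> mX nX.
pose a k : R := (odd k)%:R * (-1) ^+ k.-1./2 * k`!%:R^-1.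
have aE x : (fun k => a k * x ^+ k) = sin_coeff x.
  by apply/funext => k; rewrite /sin_coeff /a mulrAC.
have h : series (fun k => a k * gaussian_moment k (s ^+ 2)) n @[n --> \oo]
    --> \int[P]_w sin (X w).
  apply: (is_normal_cvg_mean_series mX nX).
  - by apply: continuous_measurable_fun; exact: continuous_sin.
  - by move=> x k; have := norm_sin_coeff_le x k; rewrite -aE.
  - by move=> x; rewrite aE unlock; exact: is_cvg_series_sin_coeff.
have E0 : series (fun k => a k * gaussian_moment k (s ^+ 2)) = fun=> 0.
  apply/funext => n; rewrite /series /= big1// => k _.
  by rewrite /a /gaussian_moment; case: (odd k); rewrite ?mulr0 ?mul0r.
rewrite E0 in h.
exact: (cvg_unique _ h (cvg_cst _)).
Qed.

End characteristic_function.

(** * Uncorrelated components are independent *)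

Section step_approximation.
Context {R : realType}.
Implicit Types x : R.

(* Iterating x |-> (3 x - x ^ 3) / 2, which has attracting fixed points 1 and
   -1 and maps [-1, 1] into itself, yields polynomials converging to the sign
   function boundedly on [-1, 1]. *)
Definition sign_poly k : {poly R} :=
  iter k (fun p => (3 / 2) *: p - 2^-1 *: p ^+ 3) 'X.

Lemma sign_polyS k x : (sign_poly k.+1).[x] =
  3 / 2 * (sign_poly k).[x] - 2^-1 * (sign_poly k).[x] ^+ 3.
Proof. by rewrite /sign_poly iterS !(hornerE, horner_exp). Qed.

Lemma sign_polyN k x : (sign_poly k).[- x] = - (sign_poly k).[x].
Proof.
elim: k => [|k IHk]; first by rewrite /sign_poly /= !hornerX.
by rewrite !sign_polyS IHk; ring.
Qed.

(** For a current value a in [x, 1], the next value is a + a (1 - a^2) / 2, which is at least a, and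
    its distance to 1 is (1 - a) times (1 - a)(a + 2) / 2 = 1 - a (1 + a) / 2, a factor at most 1 -
    x / 2. *)
Lemma sign_poly_pos k x : 0 < x <= 1 ->
  [/\ x <= (sign_poly k).[x], (sign_poly k).[x] <= 1
    & 1 - (sign_poly k).[x] <= (1 - x / 2) ^+ k].
Proof.
move=> /andP[x0 x1]; elim: k => [|k [a1 a2 a3]].
  by rewrite /sign_poly /= hornerX expr0; split => //; lra.
rewrite sign_polyS [_ ^+ k.+1]exprS; set a := (sign_poly k).[x] in a1 a2 a3 *.
have a0 : 0 < a by lra.
have -> : 3 / 2 * a - 2^-1 * a ^+ 3 = a + a * (1 - a ^+ 2) / 2 by field.
have aa : 0 <= 1 - a ^+ 2 by nra.
split.
- have : 0 <= a * (1 - a ^+ 2) by rewrite mulr_ge0// ltW.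
  lra.
- have -> : a + a * (1 - a ^+ 2) / 2 = 1 - (1 - a) ^+ 2 * (a + 2) / 2 by field.
  have : 0 <= (1 - a) ^+ 2 * (a + 2) by rewrite mulr_ge0 ?sqr_ge0//; lra.
  lra.
- apply: (@le_trans _ _ ((1 - x / 2) * (1 - a))); last first.
    by rewrite ler_wpM2l//; lra.
  have -> : 1 - (a + a * (1 - a ^+ 2) / 2) = (1 - a) * ((1 - a) * (a + 2) / 2).
    by field.
  rewrite mulrC ler_wpM2r//; first lra.
  nra.
Qed.

Lemma norm_sign_poly_le1 k x : `|x| <= 1 -> `|(sign_poly k).[x]| <= 1.
Proof.
wlog x0 : x / 0 <= x.
  move=> W; have [/W//|x0] := leP 0 x; rewrite -normrN => /W.
  by rewrite sign_polyN normrN; apply; lra.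
rewrite ger0_norm// => x1; have [->|xn0] := eqVneq x 0.
  have : (sign_poly k).[0] = - (sign_poly k).[0] by rewrite -sign_polyN oppr0.
  by move=> h; have -> : (sign_poly k).[0] = 0 by [lra]; rewrite normr0.
have [|h1 h2 _] := @sign_poly_pos k x; first by rewrite lt_def xn0 x0.
by rewrite ger0_norm// (le_trans x0).
Qed.

Lemma cvg_sign_poly x : `|x| <= 1 ->
  (sign_poly k).[x] @[k --> \oo] --> Num.sg x.
Proof.
have pos y : 0 < y <= 1 -> (sign_poly k).[y] @[k --> \oo] --> (1 : R).
  move=> y01; have [y0 y1] := andP y01.
  rewrite -[X in _ --> X]subr0.
  have -> : (fun k => (sign_poly k).[y]) = (fun k => 1 - (1 - (sign_poly
    k).[y])).
    by apply/funext => k; rewrite subKr.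
  apply: cvgB; first exact: cvg_cst.
  apply: (@squeeze_cvgr _ _ _ _ (cst 0) (fun k => (1 - y / 2) ^+ k)).
  - by near=> k; have [_ h1 h2] := sign_poly_pos k y01; rewrite h2 subr_ge0 h1.
  - exact: cvg_cst.
  - by apply: cvg_expr; rewrite ger0_norm; lra.
have [x0|x0|<-] := ltgtP 0 x.
- by rewrite (ger0_norm (ltW x0)) gtr0_sg// => x1; apply: pos; rewrite x0 x1.
- rewrite ltr0_norm// ltr0_sg// => x1.
  have -> : (fun k => (sign_poly k).[x]) = (fun k => - (sign_poly k).[- x]).
    by apply/funext => k; rewrite sign_polyN opprK.
  by apply: cvgN; apply: pos; rewrite x1 oppr_gt0 x0.
- move=> _; rewrite sgr0.
  have -> : (fun k => (sign_poly k).[0]) = (fun=> 0); last exact: cvg_cst.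
  apply/funext => k; have : (sign_poly k).[0] = - (sign_poly k).[0].
    by rewrite -sign_polyN oppr0.
  lra.
Unshelve. all: by end_near. Qed.

(** The map y -> (y + y^2) / 2 sends -1, 0, 1 to 0, 0, 1: it turns the sign function into the
    indicator of the open positive half-line and preserves [-1, 1]. *)
Definition step_poly k : {poly R} :=
  2^-1 *: (sign_poly k + sign_poly k ^+ 2).

Lemma norm_step_poly_le1 k x : `|x| <= 1 -> `|(step_poly k).[x]| <= 1.
Proof.
move=> /(norm_sign_poly_le1 k); rewrite /step_poly !(hornerE, horner_exp).
set a := _.[x]; rewrite !ler_norml => /andP[a1 a2]; apply/andP; split; nra.
Qed.

Lemma cvg_step_poly x : `|x| <= 1 ->
  (step_poly k).[x] @[k --> \oo] --> ((0 < x)%R%:R : R).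
Proof.
move=> x1; have h := cvg_sign_poly x1.
have -> : (0 < x)%R%:R = 2^-1 * (Num.sg x + Num.sg x * Num.sg x) :> R.
  have [x0|x0|<-] := ltgtP 0 x; rewrite ?sgr0 ?(gtr0_sg x0) ?(ltr0_sg x0) /=;
    lra.
have -> : (fun k => (step_poly k).[x]) =
    (fun k => 2^-1 * ((sign_poly k).[x] + (sign_poly k).[x] * (sign_poly
      k).[x])).
  by apply/funext => k; rewrite /step_poly !(hornerE, horner_exp) expr2.
by apply: cvgMr; apply: cvgD => //; exact: cvgM.
Qed.

(** As soon as n + 1 > |x|, the argument lies in (-1, 1), where the sine has the sign of its
    argument; the sequence is then constant. *)
Lemma cvg_step_sin x :
  ((0 < sin (n.+1%:R^-1 * x))%R%:R : R) @[n --> \oo] --> ((0 < x)%R%:R : R).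
Proof.
apply: cvg_near_cst; near=> n.
have n0 : 0 < n.+1%:R^-1 :> R by rewrite invr_gt0.
have pos y : 0 < y -> y < n.+1%:R -> 0 < sin (n.+1%:R^-1 * y).
  move=> y0 yn; apply: sin2_gt0; rewrite mulr_gt0//=.
  by rewrite mulrC ltr_pdivrMr// mulr_natr mulr2n; lra.
have xn : `|x| < n.+1%:R.
  near: n; exists (Num.truncn `|x|) => // n /= xn.
  by rewrite (lt_le_trans (truncnS_gt _))// ler_nat ltnS.
have [x0|x0|<-] := ltgtP 0 x.
- by rewrite pos// (le_lt_trans (ler_norm _) xn).
- rewrite ltNge -[x]opprK mulrN sinN oppr_le0 ltW//.
  by rewrite pos ?oppr_gt0// (le_lt_trans (ler_norm _))// normrN.
- by rewrite mulr0 sin0 ltxx.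
Unshelve. all: by end_near. Qed.

End step_approximation.

(** * Orthogonality to trigonometric functions of a variable *)

Section trigonometric_uniqueness.
Context {d : measure_display} {T : measurableType d} {R : realType}.
Variable P : probability T R.
Implicit Types (X Y W : T -> R) (M : R).

(* Trigonometric polynomials in X are orthogonal to W, hence so are the bounded
   limits step_poly k (sin (X / (n + 1))), first k, then n going to infinity. *)
Lemma integral_pos_part_eq0 W X M : measurable_fun setT W ->
  measurable_fun setT X -> (forall w, `|W w| <= M) ->
  (forall t u, \int[P]_w (W w * cos (t * X w + u)) = 0) ->
  \int[P]_w (W w * (0 < X w)%R%:R) = 0.
Proof.
move=> mW mX WM W0.
have mcos (t u : R) := measurable_cos_affine t u mX.
have msin (t : R) : measurable_fun setT (fun w => sin (t * X w)).
  have mc : measurable_fun [set: R] (@sin R).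
    by apply: continuous_measurable_fun; exact: continuous_sin.
  by apply: (measurableT_comp mc); exact: measurable_funM.
have int1 (Y : T -> R) : measurable_fun setT Y -> (forall w, `|Y w| <= 1) ->
    P.-integrable setT (EFin \o (fun w => W w * Y w)).
  move=> mY Y1; apply: (@integrable_bounded _ _ _ _ _ M).
    exact: measurable_funM.
  move=> w; rewrite normrM -[leRHS]mulr1 ler_pM//.
have sin1 (x : R) : `|sin x| <= 1 by rewrite ler_norml sin_geN1 sin_le1.
have cos1 (x : R) : `|cos x| <= 1 by rewrite ler_norml cos_geN1 cos_le1.
have isc (a t u : R) k : P.-integrable setT
    (EFin \o (fun w => W w * (sin (a * X w) ^+ k * cos (t * X w + u)))).
  apply: int1 => [|w]; first by apply: measurable_funM => //; exact:
    measurable_funX.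
  by rewrite normrM normrX mulr_ile1// exprn_ile1.
(* Product-to-sum formula, each sine being written as a cosine with phase shifted by [pi / 2]. This
   is where an arbitrary phase in the hypothesis is used. *)
have trig (a t u x : R) : sin (a * x) * cos (t * x + u) =
    2^-1 * cos ((a + t) * x + (u - pi / 2)) + 2^-1 * cos ((a - t) * x + (- u -
      pi / 2)).
  rewrite !addrA !cosBpihalf.
  have -> : (a + t) * x + u = a * x + (t * x + u) by ring.
  have -> : (a - t) * x - u = a * x - (t * x + u) by ring.
  by rewrite sinD sinB; field.
(* Frequency and phase are generalized because each factor [sin (a * X w)] changes both. *)
have A (a : R) k : forall t u,
    \int[P]_w (W w * (sin (a * X w) ^+ k * cos (t * X w + u))) = 0.
  elim: k => [|k IHk] t u.
    by under eq_Rintegral do rewrite expr0 mul1r.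
  transitivity (\int[P]_w
    (2^-1 * (W w * (sin (a * X w) ^+ k * cos ((a + t) * X w + (u - pi / 2)))) +
     2^-1 * (W w * (sin (a * X w) ^+ k * cos ((a - t) * X w + (- u - pi /
       2)))))).
    by apply: eq_Rintegral => w _; rewrite exprSr -mulrA trig; ring.
  rewrite RintegralD//; [|exact: integrable_EFinZl..].
  by rewrite !RintegralZl// !IHk !mulr0 addr0.
have B (a : R) (p : {poly R}) : \int[P]_w (W w * p.[sin (a * X w)]) = 0.
  have iC k : has_moments P (fun w => W w * sin (a * X w) ^+ k).
    apply: has_momentsM; first exact: (has_moments_bounded P mW WM).
    by apply: has_momentsX; exact: (has_moments_bounded P (msin a) (fun w =>
      sin1 (a * X w))).
  under eq_Rintegral do rewrite horner_coef mulr_sumr.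
  under eq_Rintegral do under eq_bigr do rewrite mulrCA.
  rewrite mean_sum => [|i]; last exact: has_momentsZ.
  rewrite big1// => i _; rewrite meanZ//.
  rewrite [X in _ * X](_ : _ = 0) ?mulr0// -[RHS](A a i 0 0).
  by apply: eq_Rintegral => w _; rewrite mul0r addr0 cos0 mulr1.
have mpos (Y : T -> R) : measurable_fun setT Y ->
    measurable_fun setT (fun w => (0 < Y w)%R%:R : R).
  move=> mY; have -> : (fun w => (0 < Y w)%R%:R : R) = \1_`]0, +oo[%classic \o
    Y.
    by apply/funext => w; rewrite /= indicE mem_setE in_itv/= andbT.
  by apply: measurableT_comp => //; exact: measurable_indic.
have W1 (b : bool) w : `|W w * b%:R| <= M.
  by apply: le_trans (WM w); rewrite normrM normr_nat ler_piMr//; case: b.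
have C (a : R) : \int[P]_w (W w * (0 < sin (a * X w))%R%:R) = 0.
  have h := @cvg_mean_dominated _ _ _ P
    (fun k w => W w * (step_poly k).[sin (a * X w)])
    (fun w => W w * (0 < sin (a * X w))%R%:R) (cst M).
  rewrite (funext (fun k => B a (step_poly k))) in h.
  apply: (cvg_unique _ (h _ _ _ _ _) (cvg_cst _)) => //.
  - move=> k; apply: measurable_funM => //.
    have mp : measurable_fun [set: R] (fun x : R => (step_poly k).[x]).
      by apply: continuous_measurable_fun; exact: continuous_horner.
    exact: (measurableT_comp mp (msin a)).
  - by apply: measurable_funM => //; exact: mpos.
  - exact: finite_measure_integrable_cst.
  - move=> k w; rewrite normrM -[leRHS]mulr1 ler_pM//.
    exact: norm_step_poly_le1.
  - by move=> w; apply: cvgMr; exact: cvg_step_poly.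
have h := @cvg_mean_dominated _ _ _ P
  (fun n w => W w * (0 < sin (n.+1%:R^-1 * X w))%R%:R)
  (fun w => W w * (0 < X w)%R%:R) (cst M).
rewrite (funext (fun n => C n.+1%:R^-1)) in h.
apply: (cvg_unique _ (h _ _ _ _ _) (cvg_cst _)) => //.
- by move=> n; apply: measurable_funM => //; exact: mpos.
- by apply: measurable_funM => //; exact: mpos.
- exact: finite_measure_integrable_cst.
- by move=> w; apply: cvgMr; exact: cvg_step_sin.
Qed.

(** The Borel sets [B] for which [W] integrates to 0 over the event that [X] is in [B] form a Dynkin
    system. It contains the open half-lines, which are stable under intersection and generate the
    Borel sets; moving a half-line to the origin shifts [X], and the phase absorbs the shift. *)
Lemma integral_indic_comp_eq0 W X M (A : set R) : measurable_fun setT W ->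
  measurable_fun setT X -> (forall w, `|W w| <= M) ->
  (forall t u, \int[P]_w (W w * cos (t * X w + u)) = 0) ->
  measurable A -> \int[P]_w (W w * \1_A (X w)) = 0.
Proof.
move=> mW mX WM W0 mA.
have iW : P.-integrable setT (EFin \o W) by exact: (@integrable_bounded _ _ _ _
  _ M).
have mXA (B : set R) : measurable B -> measurable (X @^-1` B).
  by move=> mB; rewrite -[X in measurable X]setTI; exact: mX.
have E (B : set R) : \int[P]_w (W w * \1_B (X w)) = \int[P]_(w in X @^-1` B) W
  w.
  rewrite [RHS]Rintegral_mkcond; apply: eq_Rintegral => w _.
  rewrite patchE indicE /=; have -> : (w \in X @^-1` B) = (X w \in B).
    by apply/idP/idP; rewrite !inE.
  by case: ifP => _; rewrite ?mulr1 ?mulr0.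
have fE (B : set R) : measurable B -> (\int[P]_(w in X @^-1` B) (W w)%:E =
    (\int[P]_(w in X @^-1` B) W w)%:E)%E.
  move=> mB; rewrite fineK//; apply: integrable_fin_num; first exact: mXA.
  by apply: integrableS iW => //; exact: mXA.
rewrite E.
suff : (\int[P]_(w in X @^-1` A) (W w)%:E = 0)%E by rewrite /Rintegral => ->.
have mE : @measurable _ R = <<s @RGenOInfty.G R>> := RGenOInfty.measurableE R.
have mA' : <<s @RGenOInfty.G R>> A by rewrite -mE.
pose Q := [set B : set R | (\int[P]_(w in X @^-1` B) (W w)%:E = 0)%E].
suff : Q A by [].
have QE (B : set R) : measurable B -> \int[P]_w (W w * \1_B (X w)) = 0 -> Q B.
  by move=> mB h; rewrite /Q /= fE// -E h.
(* At frequency and phase 0 the cosine is 1, so [W] itself has mean 0. *)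
have QT : Q setT.
  apply: QE => //; rewrite -[RHS](W0 0 0).
  by apply: eq_Rintegral => w _; rewrite indicT mul0r addr0 cos0.
apply: (@dynkin_induction _ R (@RGenOInfty.G R) Q mE) mA'.
- move=> A1 A2 [x ->] [y ->]; exists (Num.max x y).
  by apply/seteqP; split => z /=; rewrite !in_itv/= !andbT gt_max => /andP.
- exact: QT.
- move=> _ [x ->]; apply: QE; first exact: measurable_itv.
  have := @integral_pos_part_eq0 W (fun w => X w - x) M mW.
  move=> <-//.
  + apply: eq_Rintegral => w _; rewrite indicE mem_setE in_itv/= andbT subr_gt0.
    by [].
  + exact: measurable_funB.
  + move=> t u; rewrite -[RHS](W0 t (u - t * x)).
    by apply: eq_Rintegral => w _; congr (_ * cos _); ring.
- move=> S mS S0; rewrite /Q /= preimage_setC.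
  have := @integral_setU_EFin _ _ _ P (X @^-1` S) (~` (X @^-1` S)) W (mXA S mS)
     (measurableC (mXA S mS)).
  rewrite setUv S0 add0e => h; rewrite -h ?disj_set2E ?setICr//; exact: QT.
- move=> F mF tF F0; rewrite /Q /= preimage_bigcup integral_bigcup//.
  + by rewrite eseries0// => k _ _; exact: F0.
  + by move=> i j _ _ [w [/= Fi Fj]]; apply: (tF i j) => //; exists (X w).
  + by move=> k; exact: mXA.
  + by apply: integrableS iW => //; apply: bigcup_measurable => k _; exact: mXA.
Qed.

End trigonometric_uniqueness.

(** * The product rule for uncorrelated Gaussian variables *)

Section independence.
Context {d : measure_display} {T : measurableType d} {R : realType}.
Variable P : probability T R.
Implicit Types (X Y Z : T -> R).

(** For the centered variable [Y - e] factorization becomes orthogonality, to which the previous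
    result applies. *)
Lemma mean_indic_comp_factor Y X M (A : set R) : measurable_fun setT Y ->
  measurable_fun setT X -> (forall w, `|Y w| <= M) ->
  (forall t u, \int[P]_w (Y w * cos (t * X w + u)) =
     \int[P]_w Y w * \int[P]_w cos (t * X w + u)) ->
  measurable A ->
  \int[P]_w (Y w * \1_A (X w)) = \int[P]_w Y w * \int[P]_w \1_A (X w).
Proof.
move=> mY mX YM H mA; set e := \int[P]_w Y w.
have hY := has_moments_bounded P mY YM.
have hcos t u : has_moments P (fun w => cos (t * X w + u)).
  apply: (@has_moments_bounded _ _ _ _ _ 1) => [|w]; last first.
    by rewrite ler_norml cos_geN1 cos_le1.
  exact: measurable_cos_affine.
have hA : has_moments P (fun w => \1_A (X w) : R).
  apply: (@has_moments_bounded _ _ _ _ _ 1) => [|w]; last first.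
    by rewrite indicE; case: (_ \in _); rewrite ?normr0 ?normr1.
  by apply: measurableT_comp => //; exact: measurable_indic.
have := @integral_indic_comp_eq0 _ _ _ P (fun w => Y w - e) X (M + `|e|) A.
have h (Z : T -> R) : has_moments P Z ->
    \int[P]_w ((Y w - e) * Z w) = \int[P]_w (Y w * Z w) - e * \int[P]_w Z w.
  move=> hZ; rewrite -meanZ// -meanB//; [|exact: has_momentsM|exact:
    has_momentsZ].
  by apply: eq_Rintegral => w _; rewrite mulrBl.
rewrite h// => W; apply/eqP; rewrite -subr_eq0; apply/eqP; apply: W => //.
- exact: measurable_funB.
- by move=> w; rewrite (le_trans (ler_normB _ _))// lerD2r.
- by move=> t u; rewrite h// H subrr.
Qed.

Lemma independent3_of_cos X1 X2 X3 (A1 A2 A3 : set R) :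
  measurable_fun setT X1 -> measurable_fun setT X2 -> measurable_fun setT X3 ->
  (forall t1 t2 t3 u1 u2 u3,
    \int[P]_w (cos (t1 * X1 w + u1) * cos (t2 * X2 w + u2) * cos (t3 * X3 w +
      u3))
    = \int[P]_w cos (t1 * X1 w + u1) * \int[P]_w cos (t2 * X2 w + u2)
      * \int[P]_w cos (t3 * X3 w + u3)) ->
  measurable A1 -> measurable A2 -> measurable A3 ->
  \int[P]_w (\1_A1 (X1 w) * \1_A2 (X2 w) * \1_A3 (X3 w)) =
  \int[P]_w \1_A1 (X1 w) * \int[P]_w \1_A2 (X2 w) * \int[P]_w \1_A3 (X3 w).
Proof.
move=> m1 m2 m3 H mA1 mA2 mA3.
have mi (X : T -> R) (A : set R) : measurable_fun setT X -> measurable A ->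
    measurable_fun setT (fun w => \1_A (X w) : R).
  by move=> mX mA; apply: measurableT_comp => //; exact: measurable_indic.
have cos1 (x : R) : `|cos x| <= 1 by rewrite ler_norml cos_geN1 cos_le1.
have ind1 (A : set R) x : `|\1_A x : R| <= 1.
  by rewrite indicE; case: (_ \in _); rewrite ?normr0 ?normr1.
have prod1 (a b : R) : `|a| <= 1 -> `|b| <= 1 -> `|a * b| <= 1.
  by move=> ha hb; rewrite normrM mulr_ile1.
(* Setting frequency and phase to 0 removes a factor, so the rules for two factors are instances of
   the rule for three. *)
have cos00 (X : T -> R) w : cos (0 * X w + 0) = 1 by rewrite mul0r addr0 cos0.
have icos00 (X : T -> R) : \int[P]_w cos (0 * X w + 0) = 1.
  by under eq_Rintegral do rewrite cos00; rewrite mean_cst.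
(* The factors are rotated at each stage: the cosine to be replaced leaves the front and its
   indicator joins at the end. *)
have S1 t2 t3 u2 u3 :
    \int[P]_w (cos (t2 * X2 w + u2) * cos (t3 * X3 w + u3) * \1_A1 (X1 w)) =
    \int[P]_w cos (t2 * X2 w + u2) * \int[P]_w cos (t3 * X3 w + u3)
    * \int[P]_w \1_A1 (X1 w).
  have e : \int[P]_w (cos (t2 * X2 w + u2) * cos (t3 * X3 w + u3)) =
      \int[P]_w cos (t2 * X2 w + u2) * \int[P]_w cos (t3 * X3 w + u3).
    have := H 0 t2 t3 0 u2 u3; rewrite icos00 mul1r => <-.
    by apply: eq_Rintegral => w _; rewrite cos00 mul1r.
  rewrite -e; apply: (@mean_indic_comp_factor _ _ 1) => //.
  - by apply: measurable_funM; exact: measurable_cos_affine.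
  - by move=> w; exact: prod1.
  - move=> t u; rewrite e -[RHS]mulrC mulrA -H.
    by apply: eq_Rintegral => w _; rewrite mulrC mulrA.
have S2 t3 u3 :
    \int[P]_w (cos (t3 * X3 w + u3) * \1_A1 (X1 w) * \1_A2 (X2 w)) =
    \int[P]_w cos (t3 * X3 w + u3) * \int[P]_w \1_A1 (X1 w) * \int[P]_w \1_A2
      (X2 w).
  have e : \int[P]_w (cos (t3 * X3 w + u3) * \1_A1 (X1 w)) =
      \int[P]_w cos (t3 * X3 w + u3) * \int[P]_w \1_A1 (X1 w).
    have := S1 0 t3 0 u3; rewrite icos00 mul1r => <-.
    by apply: eq_Rintegral => w _; rewrite cos00 mul1r.
  rewrite -e; apply: (@mean_indic_comp_factor _ _ 1) => //.
  - by apply: measurable_funM; [exact: measurable_cos_affine|exact: mi].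
  - by move=> w; exact: prod1.
  - move=> t u; rewrite e -[RHS]mulrC mulrA -S1.
    by apply: eq_Rintegral => w _; rewrite mulrC mulrA.
have e : \int[P]_w (\1_A1 (X1 w) * \1_A2 (X2 w)) =
    \int[P]_w \1_A1 (X1 w) * \int[P]_w \1_A2 (X2 w).
  have := S2 0 0; rewrite icos00 mul1r => <-.
  by apply: eq_Rintegral => w _; rewrite cos00 mul1r.
rewrite -e; apply: (@mean_indic_comp_factor _ _ 1) => //.
- by apply: measurable_funM; exact: mi.
- by move=> w; exact: prod1.
- move=> t u; rewrite e -[RHS]mulrC mulrA -S2.
  by apply: eq_Rintegral => w _; rewrite mulrC mulrA.
Qed.

(** Stated for bare functions, so that it applies directly to linear combinations; [s = 0] is
    allowed. *)
Definition centered_normal X :=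
  measurable_fun setT X /\ exists2 s, 0 <= s & is_normal P 0 s X.

Lemma centered_normal_has_moments X : centered_normal X -> has_moments P X.
Proof. by move=> [mX [s _ nX]]; exact: is_normal_has_moments nX. Qed.

Lemma centered_normal_variance X s : measurable_fun setT X ->
  is_normal P 0 s X -> \int[P]_w X w ^+ 2 = s ^+ 2.
Proof.
move=> mX nX; rewrite (is_normal0_moment 2 mX nX) /gaussian_moment/=.
by rewrite odd_dfactS /odd_dfact big_ord0 mul1r expr1.
Qed.

Lemma centered_normal_moment X n : centered_normal X ->
  \int[P]_w X w ^+ n = gaussian_moment n (\int[P]_w X w ^+ 2).
Proof.
move=> [mX [s _ nX]].
by rewrite (centered_normal_variance mX nX) (is_normal0_moment n mX nX).
Qed.

Lemma centered_normal_cos X u : centered_normal X ->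
  \int[P]_w cos (X w + u) = expR (- (\int[P]_w X w ^+ 2 / 2)) * cos u.
Proof.
move=> [mX [s _ nX]].
have hb (f : R -> R) : continuous f -> (forall x, `|f x| <= 1) ->
    has_moments P (fun w => f (X w)).
  move=> cf f1; apply: (@has_moments_bounded _ _ _ _ _ 1) => //.
  by apply: measurableT_comp => //; exact: continuous_measurable_fun.
have hc : has_moments P (fun w => cos (X w)).
  by apply: hb => [|x]; [exact: continuous_cos|rewrite ler_norml cos_geN1
    cos_le1].
have hs : has_moments P (fun w => sin (X w)).
  by apply: hb => [|x]; [exact: continuous_sin|rewrite ler_norml sin_geN1
    sin_le1].
transitivity (\int[P]_w (cos u * cos (X w) - sin u * sin (X w))).
  by apply: eq_Rintegral => w _; rewrite cosD; ring.
rewrite meanB; [|exact: has_momentsZ..].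
rewrite !meanZ// (is_normal_mean_sin mX nX) (is_normal_mean_cos mX nX).
by rewrite (centered_normal_variance mX nX); ring.
Qed.

(** Centered joint normality in Cramer-Wold form. With explicit coefficients, a linear change of
    variables reduces to a ring identity. *)
Definition gaussian3 X Y Z := forall a b c,
  centered_normal (fun w => a * X w + b * Y w + c * Z w).

Lemma gaussian3_components X Y Z : gaussian3 X Y Z ->
  [/\ centered_normal X, centered_normal Y & centered_normal Z].
Proof.
move=> G; split.
- by have := G 1 0 0; under eq_fun do rewrite !mul0r !addr0 mul1r.
- by have := G 0 1 0; under eq_fun do rewrite !mul0r add0r addr0 mul1r.
- by have := G 0 0 1; under eq_fun do rewrite !mul0r !add0r mul1r.
Qed.

Lemma mean_sqr3 X Y Z a b c : has_moments P X -> has_moments P Y ->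
  has_moments P Z ->
  \int[P]_w (a * X w + b * Y w + c * Z w) ^+ 2 =
  a ^+ 2 * \int[P]_w X w ^+ 2 + b ^+ 2 * \int[P]_w Y w ^+ 2
  + c ^+ 2 * \int[P]_w Z w ^+ 2 + 2 * a * b * \int[P]_w (X w * Y w)
  + 2 * a * c * \int[P]_w (X w * Z w) + 2 * b * c * \int[P]_w (Y w * Z w).
Proof.
move=> hX hY hZ.
have hXY := has_momentsM hX hY; have hXZ := has_momentsM hX hZ.
have hYZ := has_momentsM hY hZ.
have hX2 := has_momentsX 2 hX; have hY2 := has_momentsX 2 hY.
have hZ2 := has_momentsX 2 hZ.
transitivity (\int[P]_w (a ^+ 2 * X w ^+ 2 + b ^+ 2 * Y w ^+ 2
  + c ^+ 2 * Z w ^+ 2 + 2 * a * b * (X w * Y w)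
  + 2 * a * c * (X w * Z w) + 2 * b * c * (Y w * Z w))).
  by apply: eq_Rintegral => w _; ring.
by rewrite !meanD ?meanZ//; do ?[exact: has_momentsZ|apply: has_momentsD].
Qed.

(** The product of three cosines is the average of the cosines of four signed sums. Without
    correlations these sums have the same variance whatever the signs, so a common exponential
    factors out, and the same identity, read on the phases, reassembles the product. *)
Lemma uncorrelated_cos X1 X2 X3 t1 t2 t3 u1 u2 u3 : gaussian3 X1 X2 X3 ->
  \int[P]_w (X1 w * X2 w) = 0 -> \int[P]_w (X1 w * X3 w) = 0 ->
  \int[P]_w (X2 w * X3 w) = 0 ->
  \int[P]_w (cos (t1 * X1 w + u1) * cos (t2 * X2 w + u2) * cos (t3 * X3 w + u3))
  = \int[P]_w cos (t1 * X1 w + u1) * \int[P]_w cos (t2 * X2 w + u2)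
    * \int[P]_w cos (t3 * X3 w + u3).
Proof.
move=> G c12 c13 c23; have [n1 n2 n3] := gaussian3_components G.
have h1 := centered_normal_has_moments n1.
have h2 := centered_normal_has_moments n2.
have h3 := centered_normal_has_moments n3.
have sgl (X : T -> R) t u : centered_normal (fun w => t * X w) -> has_moments P
  X ->
    \int[P]_w cos (t * X w + u) = expR (- (t ^+ 2 * \int[P]_w X w ^+ 2 / 2)) *
      cos u.
  move=> nX hX; rewrite centered_normal_cos// -meanZ; last exact: has_momentsX.
  by congr (expR (- (_ / 2)) * _); apply: eq_Rintegral => w _; rewrite exprMn.
have tri s2 s3 v : s2 ^+ 2 = 1 -> s3 ^+ 2 = 1 ->
  \int[P]_w cos (t1 * X1 w + s2 * t2 * X2 w + s3 * t3 * X3 w + v) =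
  expR (- (t1 ^+ 2 * \int[P]_w X1 w ^+ 2 / 2)) *
  expR (- (t2 ^+ 2 * \int[P]_w X2 w ^+ 2 / 2)) *
  expR (- (t3 ^+ 2 * \int[P]_w X3 w ^+ 2 / 2)) * cos v.
  move=> e2 e3; rewrite (centered_normal_cos _ (G _ _ _)) mean_sqr3// c12 c13
    c23.
  rewrite -!expRD !exprMn e2 e3; congr (expR _ * _).
  by field.
have g1 : centered_normal (fun w => t1 * X1 w).
  by have := G t1 0 0; under eq_fun do rewrite !mul0r !addr0.
have g2 : centered_normal (fun w => t2 * X2 w).
  by have := G 0 t2 0; under eq_fun do rewrite !mul0r add0r addr0.
have g3 : centered_normal (fun w => t3 * X3 w).
  by have := G 0 0 t3; under eq_fun do rewrite !mul0r !add0r.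
rewrite (sgl _ _ u1 g1 h1) (sgl _ _ u2 g2 h2) (sgl _ _ u3 g3 h3).
have hc s2 s3 v : has_moments P
    (fun w => cos (t1 * X1 w + s2 * t2 * X2 w + s3 * t3 * X3 w + v)).
  have [mS _] := G t1 (s2 * t2) (s3 * t3).
  apply: (@has_moments_bounded _ _ _ _ _ 1) => [|w]; last first.
    by rewrite ler_norml cos_geN1 cos_le1.
  have mc : measurable_fun [set: R] (@cos R).
    by apply: continuous_measurable_fun; exact: continuous_cos.
  apply: (measurableT_comp mc); exact: measurable_funD.
pose F s2 s3 w := 4^-1 * cos (t1 * X1 w + s2 * t2 * X2 w + s3 * t3 * X3 w
  + (u1 + s2 * u2 + s3 * u3)).
have prodcos (x y z : R) : cos x * cos y * cos z =
  4^-1 * cos (x + 1 * y + 1 * z) + 4^-1 * cos (x + 1 * y + -1 * z) +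
  4^-1 * cos (x + -1 * y + 1 * z) + 4^-1 * cos (x + -1 * y + -1 * z).
  rewrite !mul1r !mulN1r !(cosD, sinD, cosN, sinN); by field.
transitivity (\int[P]_w (F 1 1 w + F 1 (-1) w + F (-1) 1 w + F (-1) (-1) w)).
  apply: eq_Rintegral => w _; rewrite prodcos /F.
  by congr (4^-1 * cos _ + 4^-1 * cos _ + 4^-1 * cos _ + 4^-1 * cos _); ring.
have hF s2 s3 : has_moments P (F s2 s3) by exact: has_momentsZ.
rewrite !meanD//; do ?[exact: hF|apply: has_momentsD].
rewrite /F !meanZ// !tri ?expr1n ?sqrrN ?expr1n//.
transitivity (expR (- (t1 ^+ 2 * \int[P]_w X1 w ^+ 2 / 2)) *
  expR (- (t2 ^+ 2 * \int[P]_w X2 w ^+ 2 / 2)) *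
  expR (- (t3 ^+ 2 * \int[P]_w X3 w ^+ 2 / 2)) * (cos u1 * cos u2 * cos u3)).
  by rewrite prodcos; ring.
ring.
Qed.

End independence.

(** * Joint moments *)

Section polynomial_coefficients.
Context {R : realType}.
Implicit Types (p q : {poly R}) (a b c : R).

(** Otherwise the difference would vanish at as many distinct integers as its size, one more than
    its degree. *)
Lemma poly_eq_horner p q : (forall s, p.[s] = q.[s]) -> p = q.
Proof.
move=> pq; apply/eqP; rewrite -subr_eq0; apply/negPn/negP => r0.
pose s : seq R := [seq i%:R | i <- iota 0 (size (p - q))].
have := @max_poly_roots _ (p - q) s r0.
rewrite size_map size_iota ltnn => H.
have : false; last by [].
apply: H.
- by apply/allP => x _; rewrite /root !hornerE pq subrr.
- rewrite map_inj_uniq ?iota_uniq// => i j /eqP; rewrite eqr_nat => /eqP.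
  by [].
Qed.

(** For [i./2] beyond [N] the truncated exponent does no harm, since the binomial coefficient is
    0. *)
Lemma coef_exp_even a c N i : ((c%:P + a *: 'X^2) ^+ N)`_i =
  if odd i then 0 else c ^+ (N - i./2) * a ^+ i./2 *+ 'C(N, i./2).
Proof.
rewrite exprDn coef_sum.
have E (k : 'I_N.+1) : ((c%:P ^+ (N - k) * (a *: 'X^2) ^+ k) *+ 'C(N, k))`_i =
    if i == (2 * k)%N then c ^+ (N - k) * a ^+ k *+ 'C(N, k) else 0.
  rewrite coefMn exprZn -exprM -polyC_exp mul_polyC !coefZ coefXn.
  by case: eqP => _; rewrite ?mulr1// !mulr0 mul0rn.
under eq_bigr do rewrite E.
case: ifPn => oi.
  rewrite big1// => k _; case: eqP => // ik.
  by move: oi; rewrite ik mul2n odd_double.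
have i2 : i = (2 * i./2)%N by rewrite mul2n -[LHS]odd_double_half (negbTE oi).
have [iN|iN] := ltnP i./2 N.+1.
  rewrite (bigD1 (Ordinal iN))//= -i2 eqxx big1 ?addr0// => k /eqP kE.
  case: eqP => // ik; exfalso; apply: kE; apply: val_inj => /=; lia.
rewrite bin_small// mulr0n big1// => k _; case: eqP => // ik; exfalso.
by have := ltn_ord k; lia.
Qed.

(* Only even powers of the middle term contribute to an even coefficient, so all
   contributions are nonnegative; keep those of order 0 and 2. *)
Lemma coef_exp_ge a N m : (0 < m)%N -> (m < N)%N ->
  'C(N, m)%:R + 'C(N, 2)%:R * 'C(N - 2, m.-1)%:R * a ^+ 2 <=
  ((1%:P + a *: 'X + 'X^2) ^+ N)`_(2 * m).
Proof.
move=> m0 mN.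
have -> : 1%:P + a *: 'X + 'X^2 = (1%:P + 1 *: 'X^2) + a *: 'X :> {poly R}.
  by rewrite scale1r addrAC.
rewrite exprDn coef_sum.
pose t j := (((1%:P + 1 *: 'X^2) ^+ (N - j) * (a *: 'X) ^+ j) *+ 'C(N, j))`_(2
  * m).
have tE j : t j = if (2 * m < j)%N || odd j then 0 else
    a ^+ j * 'C(N - j, (2 * m - j)./2)%:R * 'C(N, j)%:R.
  rewrite /t coefMn exprZn -scalerAr coefZ coefMXn.
  case: ltnP => /= jm; first by rewrite mulr0 mul0rn.
  rewrite coef_exp_even oddB// mul2n odd_double /=.
  case: ifP => _; first by rewrite mulr0 mul0rn.
  by rewrite !expr1n mul1r [RHS]mulr_natr.
have t0 j : 0 <= t j.
  rewrite tE; case: ifPn => //; rewrite negb_or => /andP[_ oj].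
  rewrite !mulr_ge0// -[j]odd_double_half (negbTE oj) -mul2n exprM.
  by rewrite exprn_ge0// sqr_ge0.
have N2 : (2 < N.+1)%N by lia.
rewrite (bigD1 ord0)//= (bigD1 (Ordinal N2))//= addrA -[leLHS]addr0.
apply: lerD; last by apply: sumr_ge0 => j _; exact: t0.
rewrite -/(t 0%N) -/(t 2%N) !tE /= ltnNge leq_pmulr//=.
have -> : ((2 * m - 0)./2 = m)%N by rewrite subn0 mul2n doubleK.
have -> : ((2 * m - 2)./2 = m.-1)%N.
  by rewrite -[X in (_ - X)%N]muln1 -mulnBr mul2n doubleK subn1.
rewrite subn0 bin0 expr0 mulr1 mul1r lerD2l.
by rewrite [leLHS]mulrC [leLHS]mulrCA [leLHS]mulrC [X in X * _]mulrC.
Qed.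

(** Both sides follow from (2n)! = (2n-1)!! 2^n n!. It converts the correlation-free term of a mixed
    moment into the product of the univariate moments. *)
Lemma odd_dfact_bin m n :
  (odd_dfact (m + n) * 'C(m + n, m) =
   'C(2 * (m + n), 2 * m) * (odd_dfact m * odd_dfact n))%N.
Proof.
have := @bin_fact (2 * (m + n)) (2 * m); have := @bin_fact (m + n) m.
rewrite leq_mul2l leq_addr => /(_ isT) e1 /(_ isT).
rewrite -mulnBr addKn in e1 *.
rewrite !mul2n !fact_double -e1 expnD => e2.
have p : (0 < 2 ^ m * 2 ^ n * (m`! * n`!))%N by rewrite !muln_gt0 !expn_gt0
  !fact_gt0.
apply/eqP; rewrite -(eqn_pmul2r p); apply/eqP; lia.
Qed.

End polynomial_coefficients.

(** * Mixed moments of Gaussian pairs and triples *)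

Section joint_moments.
Context {d : measure_display} {T : measurableType d} {R : realType}.
Variable P : probability T R.
Implicit Types (X Y Z U V : T -> R).

(** Expand the power under the mean and compare coefficients in [s]. The weight [Y] will be 1, or
    [Z] and its square for a variable [Z] uncorrelated with [U] and [V]. *)
Lemma coef_mean_expD Y U V n (p : {poly R}) : has_moments P Y ->
  has_moments P U -> has_moments P V ->
  (forall s, \int[P]_w (Y w * (s * U w + V w) ^+ n) = p.[s]) ->
  forall i, (i <= n)%N ->
  'C(n, i)%:R * \int[P]_w (Y w * (U w ^+ i * V w ^+ (n - i))) = p`_i.
Proof.
move=> hY hU hV H i i_n.
pose mu (j : nat) := \int[P]_w (Y w * (U w ^+ j * V w ^+ (n - j))).
have hUV j : has_moments P (fun w => Y w * (U w ^+ j * V w ^+ (n - j))).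
  by do 2 apply: has_momentsM => //; exact: has_momentsX.
have -> : p = \poly_(j < n.+1) ('C(n, j)%:R * mu j).
  apply: poly_eq_horner => s; rewrite -H horner_poly.
  transitivity (\int[P]_w (\sum_(j < n.+1)
      ('C(n, j)%:R * s ^+ j) * (Y w * (U w ^+ j * V w ^+ (n - j))))).
    apply: eq_Rintegral => w _; rewrite addrC exprDn mulr_sumr.
    apply: eq_bigr => j _; rewrite exprMn -mulr_natr; ring.
  rewrite mean_sum; last by move=> j; exact: has_momentsZ.
  by apply: eq_bigr => j _; rewrite meanZ// mulrAC.
by rewrite coef_poly ltnS i_n.
Qed.

Definition gaussian2 U V := forall a b,
  centered_normal P (fun w => a * U w + b * V w).

Lemma gaussian2_has_moments U V : gaussian2 U V ->
  has_moments P U /\ has_moments P V.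
Proof.
move=> G; split; apply: centered_normal_has_moments.
- by have := G 1 0; under eq_fun do rewrite mul0r addr0 mul1r.
- by have := G 0 1; under eq_fun do rewrite mul0r add0r mul1r.
Qed.

Lemma gaussian2C U V : gaussian2 U V -> gaussian2 V U.
Proof. by move=> G a b; have := G b a; under eq_fun do rewrite addrC. Qed.

Lemma mean_sqr2 U V s : has_moments P U -> has_moments P V ->
  \int[P]_w (s * U w + V w) ^+ 2 = s ^+ 2 * \int[P]_w U w ^+ 2
    + 2 * s * \int[P]_w (U w * V w) + \int[P]_w V w ^+ 2.
Proof.
move=> hU hV; have hUV := has_momentsM hU hV.
have hU2 := has_momentsX 2 hU; have hV2 := has_momentsX 2 hV.
transitivity (\int[P]_w (s ^+ 2 * U w ^+ 2 + 2 * s * (U w * V w) + V w ^+ 2)).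
  by apply: eq_Rintegral => w _; ring.
by rewrite !meanD ?meanZ//; do ?[exact: has_momentsZ|apply: has_momentsD].
Qed.

Lemma gaussian2_coef U V i k N : gaussian2 U V -> (i + k = 2 * N)%N ->
  'C(2 * N, i)%:R * \int[P]_w (U w ^+ i * V w ^+ k) =
  (odd_dfact N)%:R * (((\int[P]_w V w ^+ 2)%:P
    + (2 * \int[P]_w (U w * V w)) *: 'X + (\int[P]_w U w ^+ 2) *: 'X^2) ^+
      N)`_i.
Proof.
move=> G ik; have [hU hV] := gaussian2_has_moments G.
rewrite -coefZ.
have iN : (i <= 2 * N)%N by rewrite -ik leq_addr.
have kE : (2 * N - i = k)%N by rewrite -ik addKn.
rewrite -(@coef_mean_expD (fun=> 1) U V (2 * N)%N _ (has_moments_cst P 1) hU hV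
  _ i iN).
  by congr (_ * _); apply: eq_Rintegral => w _; rewrite mul1r kE.
move=> s; under eq_Rintegral do rewrite mul1r.
have Gs : centered_normal P (fun w => s * U w + V w).
  by have := G s 1; under eq_fun do rewrite mul1r.
rewrite (centered_normal_moment _ Gs) /gaussian_moment mul2n odd_double doubleK.
rewrite hornerZ horner_exp mean_sqr2//; congr (_ * _ ^+ _).
by rewrite !(hornerD, hornerZ, hornerC, hornerX, hornerXn); ring.
Qed.

Lemma gaussian2_odd U V i k : gaussian2 U V -> odd (i + k) ->
  \int[P]_w (U w ^+ i * V w ^+ k) = 0.
Proof.
move=> G oik; have [hU hV] := gaussian2_has_moments G.
have ik : (i <= i + k)%N by rewrite leq_addr.
have h : forall s, \int[P]_w (1 * (s * U w + V w) ^+ (i + k)) = (0 : {poly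
  R}).[s].
  move=> s; under eq_Rintegral do rewrite mul1r.
  have Gs : centered_normal P (fun w => s * U w + V w).
    by have := G s 1; under eq_fun do rewrite mul1r.
  by rewrite (centered_normal_moment _ Gs) /gaussian_moment oik horner0.
have := coef_mean_expD (has_moments_cst P 1) hU hV h ik.
rewrite coef0 addKn => /eqP; rewrite mulf_eq0 pnatr_eq0 -leqn0 leqNgt bin_gt0
  ik /=.
by move=> /eqP <-; apply: eq_Rintegral => w _; rewrite mul1r.
Qed.

Lemma odd_dfact_gt0 n : (0 < odd_dfact n)%N.
Proof. by rewrite prodn_gt0// => i; rewrite addn1. Qed.

Lemma centered_normal_even_moment U n : centered_normal P U ->
  \int[P]_w U w ^+ (2 * n) = (odd_dfact n)%:R * (\int[P]_w U w ^+ 2) ^+ n.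
Proof.
move=> nU; rewrite (centered_normal_moment _ nU) /gaussian_moment.
by rewrite mul2n odd_double doubleK.
Qed.

(** Without covariance the variance of s U + V is even in s, so the coefficient of s in its powers
    is 0. *)
Lemma uncorrelated2_mean U V k : gaussian2 U V ->
  \int[P]_w (U w * V w) = 0 -> \int[P]_w (U w * V w ^+ k) = 0.
Proof.
move=> G UV0; have [ok|ek] := boolP (odd k); last first.
  have := @gaussian2_odd U V 1 k G; rewrite add1n /= ek => /(_ isT).
  by under eq_Rintegral do rewrite expr1.
have kE : (1 + k = 2 * (k.+1./2))%N.
  by rewrite mul2n add1n -[LHS]odd_double_half /= ok.
have := gaussian2_coef G kE; rewrite UV0 mulr0 scale0r addr0 coef_exp_even
  mulr0.
under eq_Rintegral do rewrite expr1.
move=> /eqP; rewrite mulf_eq0 pnatr_eq0 -leqn0 leqNgt bin_gt0 -kE leq_addr /=.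
by move=> /eqP.
Qed.

(** For k = 2n, compare the coefficients of s^2: 'C(2n + 2, 2) = (n + 1)(2n + 1), where n + 1 is the
    binomial factor of the power and 2n + 1 the ratio of the double factorials. *)
Lemma uncorrelated2_mean_sqr U V k : gaussian2 U V ->
  \int[P]_w (U w * V w) = 0 ->
  \int[P]_w (U w ^+ 2 * V w ^+ k) = \int[P]_w U w ^+ 2 * \int[P]_w V w ^+ k.
Proof.
move=> G UV0.
have nV : centered_normal P V.
  by have := G 0 1; under eq_fun do rewrite mul0r add0r mul1r.
have [ok|ek] := boolP (odd k).
  rewrite [X in _ = _ * X](centered_normal_moment _ nV) /gaussian_moment ok
    mulr0.
  by apply: gaussian2_odd => //=; rewrite negbK.
have {ek} -> : (k = 2 * k./2)%N.
  by rewrite mul2n -[LHS]odd_double_half (negbTE ek).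
move: k./2 => n; have kE : (2 + 2 * n = 2 * n.+1)%N by lia.
rewrite centered_normal_even_moment//.
have := gaussian2_coef G kE; rewrite UV0 mulr0 scale0r addr0 coef_exp_even /=.
rewrite subn1 expr1 bin1 odd_dfactS => h.
have c0 : ('C(2 * n.+1, 2)%:R : R) != 0.
  by rewrite pnatr_eq0 -lt0n bin_gt0; lia.
apply: (mulfI c0); rewrite h bin2 natrM.
have -> : ((2 * n.+1 * (2 * n.+1).-1)./2 = n.+1 * (2 * n + 1))%N.
  by rewrite -mulnA mul2n doubleK; congr (_ * _)%N; lia.
rewrite natrM; ring.
Qed.

(** The polynomial 1 + 2 r s + s^2 does not see the order of the pair. This identifies the moment
    with exchanged roles in assertion (2). *)
Lemma standard_moment_sym U V i k : gaussian2 U V ->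
  \int[P]_w U w ^+ 2 = 1 -> \int[P]_w V w ^+ 2 = 1 ->
  \int[P]_w (U w ^+ i * V w ^+ k) = \int[P]_w (U w ^+ k * V w ^+ i).
Proof.
move=> G u1 v1; have [oik|eik] := boolP (odd (i + k)).
  by rewrite !gaussian2_odd// addnC.
have ik : (i + k = 2 * (i + k)./2)%N.
  by rewrite mul2n -[LHS]odd_double_half (negbTE eik).
have h1 := gaussian2_coef G ik; have h2 := gaussian2_coef (gaussian2C G) ik.
have e : \int[P]_w (V w * U w) = \int[P]_w (U w * V w).
  by apply: eq_Rintegral => w _; rewrite mulrC.
rewrite e u1 v1 in h2; rewrite u1 v1 -h2 in h1.
have c0 : ('C(2 * (i + k)./2, i)%:R : R) != 0.
  by rewrite pnatr_eq0 -lt0n bin_gt0 -ik leq_addr.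
rewrite (mulfI c0 h1); apply: eq_Rintegral => w _; exact: mulrC.
Qed.

(** For r^2 = 1 the polynomial 1 + 2 r s + s^2 is the square of r + s, and the binomial theorem
    gives the coefficient. *)
Lemma standard_moment_collinear U V i k N : gaussian2 U V ->
  \int[P]_w U w ^+ 2 = 1 -> \int[P]_w V w ^+ 2 = 1 ->
  (\int[P]_w (U w * V w)) ^+ 2 = 1 -> (i + k = 2 * N)%N ->
  \int[P]_w (U w ^+ i * V w ^+ k) =
  (odd_dfact N)%:R * (\int[P]_w (U w * V w)) ^+ k.
Proof.
move=> G u1 v1; set r := \int[P]_w (U w * V w) => r1 ik.
have := gaussian2_coef G ik; rewrite u1 v1 -/r.
have -> : 1%:P + (2 * r) *: 'X + 1 *: 'X^2 = (r%:P + 'X) ^+ 2 :> {poly R}.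
  rewrite sqrrD -polyC_exp r1 scale1r mul_polyC.
  by rewrite mulr_natl scalerMnl.
rewrite -exprM exprDn coef_sum.
have i_N : (i < (2 * N).+1)%N by rewrite ltnS -ik leq_addr.
rewrite (bigD1 (Ordinal i_N))//= big1 ?addr0; last first.
  move=> j /eqP ji; rewrite coefMn -polyC_exp mul_polyC coefZ coefXn.
  case: eqP => [ij|_]; last by rewrite mulr0 mul0rn.
  by exfalso; apply: ji; exact: val_inj.
rewrite coefMn -polyC_exp mul_polyC coefZ coefXn eqxx mulr1.
have c0 : ('C(2 * N, i)%:R : R) != 0 by rewrite pnatr_eq0 -lt0n bin_gt0.
move=> h; apply: (mulfI c0); rewrite h -ik addKn -mulr_natr; ring.
Qed.

(** In the coefficient bound at [a = 2 * r], the first term yields exactly the product of double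
    factorials; the second is proportional to r^2, with positive binomials because [m] and [n] are
    positive. *)
Lemma standard_moment_ge U V m n : gaussian2 U V ->
  \int[P]_w U w ^+ 2 = 1 -> \int[P]_w V w ^+ 2 = 1 ->
  (0 < m)%N -> (0 < n)%N ->
  (odd_dfact m)%:R * (odd_dfact n)%:R
    <= \int[P]_w (U w ^+ (2 * m) * V w ^+ (2 * n))
  /\ (\int[P]_w (U w * V w) != 0 -> (odd_dfact m)%:R * (odd_dfact n)%:R
    < \int[P]_w (U w ^+ (2 * m) * V w ^+ (2 * n))).
Proof.
move=> G u1 v1 m0 n0; set r := \int[P]_w (U w * V w).
have mn : (2 * m + 2 * n = 2 * (m + n))%N by rewrite mulnDr.
have := gaussian2_coef G mn; rewrite u1 v1 -/r scale1r.
have mN : (m < m + n)%N by rewrite -addn1 leq_add2l.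
have := coef_exp_ge (2 * r) m0 mN.
set c := _`__; set I := \int[P]_w _ => h1 h2.
have c0 : 0 < ('C(2 * (m + n), 2 * m)%:R : R).
  by rewrite ltr0n bin_gt0 leq_mul2l leq_addr.
have o0 : 0 < (odd_dfact (m + n))%:R :> R by rewrite ltr0n odd_dfact_gt0.
have e : (odd_dfact (m + n))%:R * 'C(m + n, m)%:R =
    'C(2 * (m + n), 2 * m)%:R * ((odd_dfact m)%:R * (odd_dfact n)%:R) :> R.
  by rewrite -!natrM odd_dfact_bin.
split; [|move=> r0].
- rewrite -(ler_pM2l c0) h2 -e ler_pM2l// (le_trans _ h1)// lerDl.
  by rewrite mulr_ge0// sqr_ge0.
- rewrite -(ltr_pM2l c0) h2 -e ltr_pM2l// (lt_le_trans _ h1)// ltrDl.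
  rewrite mulr_gt0 ?exprn_even_gt0 ?mulf_neq0//.
  by rewrite mulr_gt0// ltr0n bin_gt0; lia.
Qed.

Lemma uncorrelated3_mean Z U V i k : gaussian3 P Z U V ->
  \int[P]_w (Z w * U w) = 0 -> \int[P]_w (Z w * V w) = 0 ->
  \int[P]_w (Z w * (U w ^+ i * V w ^+ k)) = 0 /\
  \int[P]_w (Z w ^+ 2 * (U w ^+ i * V w ^+ k)) =
    \int[P]_w Z w ^+ 2 * \int[P]_w (U w ^+ i * V w ^+ k).
Proof.
move=> G ZU ZV; have [nZ nU nV] := gaussian3_components G.
have hZ := centered_normal_has_moments nZ.
have hU := centered_normal_has_moments nU.
have hV := centered_normal_has_moments nV.
have G2 s : gaussian2 Z (fun w => s * U w + V w).
  move=> a b; have := G a (b * s) b; congr (centered_normal P _).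
  by apply/funext => w; ring.
have ZW s : \int[P]_w (Z w * (s * U w + V w)) = 0.
  transitivity (\int[P]_w (s * (Z w * U w) + Z w * V w)).
    by apply: eq_Rintegral => w _; ring.
  rewrite meanD; [|by apply: has_momentsZ; exact: has_momentsM|exact:
    has_momentsM].
  by rewrite meanZ ?ZU ?ZV ?mulr0 ?addr0//; exact: has_momentsM.
have ik : (i <= i + k)%N by rewrite leq_addr.
have c0 : ('C(i + k, i)%:R : R) != 0 by rewrite pnatr_eq0 -lt0n bin_gt0.
have h1 (s : R) : \int[P]_w (Z w * (s * U w + V w) ^+ (i + k)) = (0 : {poly
  R}).[s].
  by rewrite horner0; exact: uncorrelated2_mean.
have e1 := coef_mean_expD hZ hU hV h1 ik.
(* The mean of [(s * U w + V w) ^+ (i + k)] as a polynomial in [s], given by its coefficients, which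
   are the moments sought. *)
pose p : {poly R} := \poly_(j < (i + k).+1)
  ('C(i + k, j)%:R * \int[P]_w (U w ^+ j * V w ^+ (i + k - j))).
have h2 (s : R) : \int[P]_w (Z w ^+ 2 * (s * U w + V w) ^+ (i + k)) =
    ((\int[P]_w Z w ^+ 2) *: p).[s].
  rewrite uncorrelated2_mean_sqr// hornerZ; congr (_ * _).
  rewrite horner_poly.
  transitivity (\int[P]_w (\sum_(j < (i + k).+1)
      ('C(i + k, j)%:R * s ^+ j) * (U w ^+ j * V w ^+ (i + k - j)))).
    apply: eq_Rintegral => w _; rewrite addrC exprDn.
    apply: eq_bigr => j _; rewrite exprMn -mulr_natr; ring.
  have hj j : has_moments P (fun w => U w ^+ j * V w ^+ (i + k - j)).
    by apply: has_momentsM; exact: has_momentsX.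
  rewrite mean_sum; last by move=> j; exact: has_momentsZ.
  by apply: eq_bigr => j _; rewrite meanZ// mulrAC.
have e2 := coef_mean_expD (has_momentsX 2 hZ) hU hV h2 ik.
rewrite addKn in e1 e2; split.
  by apply: (mulfI c0); rewrite e1 coef0 mulr0.
apply: (mulfI c0); rewrite e2 coefZ coef_poly ltnS ik addKn; ring.
Qed.

End joint_moments.

(** * Independence and Gaussian tuples of random variables *)

Section mutual_independence.
Context {d : measure_display} {T : measurableType d} {R : realType}.
Variable P : probability T R.

(** The product rule on rectangles determines the joint law, which is therefore the product of the
    marginal laws; Fubini's theorem concludes. *)
Lemma independent_mean_mul (X Y : {RV P >-> R}) :
  has_moments P X -> has_moments P Y ->
  (forall A B : set R, measurable A -> measurable B ->
     P (X @^-1` A `&` Y @^-1` B) = (P (X @^-1` A) * P (Y @^-1` B))%E) ->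
  \int[P]_w (X w * Y w) = \int[P]_w X w * \int[P]_w Y w.
Proof.
move=> hX hY XY; have hXY := has_momentsM hX hY.
have iX := has_momentsW hX; have iY := has_momentsW hY.
have iXY := has_momentsW hXY.
pose XY_ w := (X w, Y w).
have mXY : measurable_fun setT XY_ by apply: measurable_fun_pair.
pose Z : {RV P >-> (R * R)%type} := HB.pack XY_ (isMeasurableFun.Build _ _ _ _
  XY_ mXY).
pose m1 := distribution P X; pose m2 := distribution P Y.
pose f (z : R * R) := (z.1 * z.2)%:E.
have mf : measurable_fun setT f.
  by apply/measurable_EFinP; apply: measurable_funM.
have E (S : set (R * R)) : measurable S -> (m1 \x m2)%E S = distribution P Z S.
  by apply: product_measure_unique => A B mA mB; rewrite -XY.
have fi : (m1 \x m2)%E.-integrable setT f.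
  apply/integrableP; split => //.
  rewrite (@eq_measure_integral _ _ _ setT (distribution P Z)); last first.
    by move=> A mA _; exact: E.
  rewrite ge0_integral_distribution//; last exact: measurableT_comp.
  by have /integrableP[] := iXY.
have e1 : (\int[P]_w (X w * Y w)%:E = \int[m1 \x m2]_z f z)%E.
  rewrite (@eq_measure_integral _ _ _ setT (distribution P Z)); last first.
    by move=> A mA _; exact: E.
  by rewrite integral_distribution.
have idE : measurable_fun [set: R] (fun y : R => y%:E) by
  exact/measurable_EFinP.
have eY : (\int[m2]_y y%:E = (\int[P]_w Y w)%:E)%E.
  by rewrite integral_distribution// fineK// integrable_fin_num.
have eX : (\int[m1]_y y%:E = (\int[P]_w X w)%:E)%E.
  by rewrite integral_distribution// fineK// integrable_fin_num.
have i2 : m2.-integrable setT (fun y : R => y%:E).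
  apply/integrableP; split => //.
  rewrite ge0_integral_distribution//; last exact: measurableT_comp.
  by have /integrableP[] := iY.
have i1 : m1.-integrable setT (fun y : R => y%:E).
  apply/integrableP; split => //.
  rewrite ge0_integral_distribution//; last exact: measurableT_comp.
  by have /integrableP[] := iX.
apply: EFin_inj; rewrite EFinM -eX -eY.
transitivity (\int[P]_w (X w * Y w)%:E)%E.
  by rewrite fineK// integrable_fin_num.
rewrite e1 -integral12_prod_meas1// /fubini_F /f /=.
under eq_integral do (under eq_integral do rewrite EFinM).
under eq_integral do rewrite integralZl//.
by rewrite eY integralZr// -eY.
Qed.

Lemma mutually_independent_uncorrelated n (X : n.-tuple {RV P >-> R}) i j :
  i != j -> mutually_independent X ->
  has_moments P (tnth X i) -> has_moments P (tnth X j) ->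
  \int[P]_w (tnth X i w * tnth X j w) =
  \int[P]_w tnth X i w * \int[P]_w tnth X j w.
Proof.
move=> ij iX hi hj; apply: independent_mean_mul => // A B mA mB.
have := iX [set i; j]%SET (fun k => if k == i then A else B).
rewrite big_setU1/= ?inE// big_set1 eqxx [j == i]eq_sym (negbTE ij) => <-.
  congr (P _); apply/seteqP; split => w /=.
    move=> [wA wB] k /=; rewrite !inE => /orP[/eqP ->|/eqP ->].
      by rewrite eqxx.
    by rewrite eq_sym (negbTE ij).
  move=> h; split.
    by have := h i; rewrite /= !inE eqxx; apply.
  by have := h j; rewrite /= !inE eqxx orbT eq_sym (negbTE ij); apply.
by move=> k; case: ifP.
Qed.

Lemma mean_indic (X : {RV P >-> R}) (A : set R) : measurable A ->
  (\int[P]_w \1_A (X w))%:E = P (X @^-1` A).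
Proof.
move=> mA; have mXA : measurable (X @^-1` A).
  by rewrite -[X in measurable X]setTI; exact: measurable_funP.
rewrite /Rintegral.
have -> : (\int[P]_w (\1_A (X w))%:E = \int[P]_w (\1_(X @^-1` A) w)%:E)%E by [].
by rewrite integral_indic// setIT fineK// fin_num_measure.
Qed.

Lemma uncorrelated_mutually_independent (X1 X2 X3 : {RV P >-> R}) :
  gaussian3 P X1 X2 X3 ->
  \int[P]_w (X1 w * X2 w) = 0 -> \int[P]_w (X1 w * X3 w) = 0 ->
  \int[P]_w (X2 w * X3 w) = 0 ->
  mutually_independent [tuple X1; X2; X3].
Proof.
move=> G c12 c13 c23 J A mA.
(* The whole line at indices outside [J] turns the rule for a subfamily into the rule for all three
   variables. *)
pose B i := if i \in J then A i else setT.
have mB i : measurable (B i) by rewrite /B; case: ifP.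
have -> : \bigcap_(i in [set` J]) (tnth [tuple X1; X2; X3] i @^-1` A i) =
    X1 @^-1` B ord0 `&` X2 @^-1` B (lift ord0 ord0) `&`
    X3 @^-1` B (lift ord0 (lift ord0 ord0)).
  apply/seteqP; split => w /=.
    by move=> h; split; [split|]; rewrite /B; case: ifP => // iJ;
      have := h _ iJ; rewrite /= (tnth_nth X1).
  move=> [[h0 h1] h2] i /= iJ.
  case: (unliftP ord0 i) iJ => [i1 ->|->].
    case: (unliftP ord0 i1) => [i2 ->|-> iJ].
      rewrite (ord1 i2) => iJ; move: h2.
      by rewrite /B iJ (tnth_nth X1).
    by move: h1; rewrite /B iJ (tnth_nth X1).
  by move=> iJ; move: h0; rewrite /B iJ (tnth_nth X1).
have -> : (\prod_(i in J) P (tnth [tuple X1; X2; X3] i @^-1` A i) =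
    P (X1 @^-1` B ord0) * P (X2 @^-1` B (lift ord0 ord0))
    * P (X3 @^-1` B (lift ord0 (lift ord0 ord0))))%E.
  rewrite big_mkcond/= !big_ord_recl big_ord0 mule1 muleA.
  by congr (_ * _ * _)%E; rewrite /B; case: ifP => _ //;
    rewrite preimage_setT probability_setT.
have m1 : measurable_fun setT X1 by exact: measurable_funP.
have m2 : measurable_fun setT X2 by exact: measurable_funP.
have m3 : measurable_fun setT X3 by exact: measurable_funP.
have H t1 t2 t3 u1 u2 u3 := uncorrelated_cos t1 t2 t3 u1 u2 u3 G c12 c13 c23.
have := independent3_of_cos m1 m2 m3 H (mB ord0) (mB (lift ord0 ord0))
  (mB (lift ord0 (lift ord0 ord0))).
move: (mB ord0) (mB (lift ord0 ord0)) (mB (lift ord0 (lift ord0 ord0))).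
move: (B ord0) (B (lift ord0 ord0)) (B (lift ord0 (lift ord0 ord0))) => B1 B2
  B3 mB1 mB2 mB3.
move=> h; have {h} := congr1 EFin h.
rewrite !EFinM !mean_indic// => <-.
have mXB (X : {RV P >-> R}) (S : set R) : measurable S -> measurable (X @^-1`
  S).
  by move=> mS; rewrite -[X in measurable X]setTI; exact: measurable_funP.
rewrite /Rintegral.
have -> : (\int[P]_w (\1_B1 (X1 w) * \1_B2 (X2 w) * \1_B3 (X3 w))%:E =
   \int[P]_w (\1_(X1 @^-1` B1 `&` X2 @^-1` B2 `&` X3 @^-1` B3) w)%:E)%E.
  apply: eq_integral => w _; congr EFin.
  by rewrite !indicI.
have mI : measurable (X1 @^-1` B1 `&` X2 @^-1` B2 `&` X3 @^-1` B3).
  by do ?apply: measurableI; exact: mXB.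
by rewrite integral_indic// setIT fineK// fin_num_measure.
Qed.

(** The parameter [m] of a combination is its mean, which is 0 by linearity; integrability of a
    component comes from the combination that selects it. *)
Lemma jointly_gaussian_centered n (X : n.-tuple {RV P >-> R}) :
  jointly_gaussian X -> (forall i, 'E_P[tnth X i] = 0)%E ->
  forall c, centered_normal P (fun w => \sum_(i < n) c i * tnth X i w).
Proof.
move=> G E0.
have hX i : has_moments P (tnth X i).
  have [m [s [s0 nX]]] := G (fun j => (j == i)%:R).
  have e : (fun w => \sum_(j < n) (j == i)%:R * tnth X j w) = tnth X i.
    apply/funext => w; rewrite (bigD1 i)//= eqxx mul1r big1 ?addr0// => j ji.
    by rewrite (negbTE ji) mul0r.
  by rewrite e in nX; apply: is_normal_has_moments nX; exact: measurable_funP.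
move=> c; have hS : has_moments P (fun w => \sum_(i < n) c i * tnth X i w).
  by apply: has_moments_sum => i; exact: has_momentsZ.
have [m [s [s0 nS]]] := G c.
have mS : measurable_fun setT (fun w => \sum_(i < n) c i * tnth X i w) by case:
  hS.
split => //; exists s => //.
have := is_normal_mean mS nS.
rewrite mean_sum; last by move=> i; exact: has_momentsZ.
rewrite big1 => [m0|i _]; first by rewrite [X in is_normal _ X _](_ : 0 = m).
rewrite meanZ//; have := E0 i; rewrite expectation_mean// => -[->].
by rewrite mulr0.
Qed.

Lemma centered_gaussian3 (X1 X2 X3 : {RV P >-> R}) :
  centered_gaussian [tuple X1; X2; X3] -> gaussian3 P X1 X2 X3.
Proof.
move=> [G E0 _] a b c.
have := jointly_gaussian_centered G E0 (tnth [tuple a; b; c]).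
by congr (centered_normal P _); apply/funext => w;
  rewrite !big_ord_recl big_ord0 addr0 !(tnth_nth (0 : R)) !(tnth_nth X1) addrA.
Qed.

Lemma jointly_gaussian2 (U V : {RV P >-> R}) :
  jointly_gaussian [tuple U; V] -> ('E_P[U] = 0)%E -> ('E_P[V] = 0)%E ->
  gaussian2 P U V.
Proof.
move=> G EU EV a b.
have E0 i : ('E_P[tnth [tuple U; V] i] = 0)%E.
  case: (unliftP ord0 i) => [i1 ->|->]; rewrite (tnth_nth U)//=.
  by rewrite (ord1 i1).
have := jointly_gaussian_centered G E0 (tnth [tuple a; b]).
by congr (centered_normal P _); apply/funext => w;
  rewrite !big_ord_recl big_ord0 addr0 !(tnth_nth (0 : R)) !(tnth_nth U).
Qed.

Lemma gaussian3_jointly_gaussian (X1 X2 X3 : {RV P >-> R}) :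
  gaussian3 P X1 X2 X3 -> jointly_gaussian [tuple X1; X2; X3].
Proof.
move=> G c.
have [mS [s s0 nS]] := G (c ord0) (c (lift ord0 ord0)) (c (lift ord0 (lift ord0
  ord0))).
exists 0, s; split => //.
move: nS; congr (is_normal P 0 s _); apply/funext => w.
by rewrite !big_ord_recl big_ord0 addr0 !(tnth_nth X1) addrA.
Qed.

Lemma gaussian2_jointly_gaussian (U V : {RV P >-> R}) :
  gaussian2 P U V -> jointly_gaussian [tuple U; V].
Proof.
move=> G c; have [mS [s s0 nS]] := G (c ord0) (c (lift ord0 ord0)).
exists 0, s; split => //.
move: nS; congr (is_normal P 0 s _); apply/funext => w.
by rewrite !big_ord_recl big_ord0 addr0 !(tnth_nth U).
Qed.

Lemma variance_centered (X : {RV P >-> R}) : has_moments P X ->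
  ('E_P[X] = 0)%E -> ('V_P[X] = (\int[P]_w X w ^+ 2)%:E)%E.
Proof.
move=> hX EX; rewrite -expectation_mean; last exact: has_momentsX.
rewrite /variance covariance.unlock EX /=; congr ('E_P[_])%E.
by apply/funext => w; rewrite !fctE /= subr0 expr2.
Qed.

Lemma centered_normal_mean0 (X : T -> R) : centered_normal P X ->
  ('E_P[X] = 0)%E.
Proof.
move=> nX; have hX := centered_normal_has_moments nX.
by case: nX => mX [s _ nX]; rewrite expectation_mean// (is_normal_mean mX nX).
Qed.

Lemma gaussian3_centered_gaussian (X1 X2 X3 : {RV P >-> R}) :
  gaussian3 P X1 X2 X3 -> 0 < \int[P]_w X1 w ^+ 2 ->
  0 < \int[P]_w X2 w ^+ 2 -> 0 < \int[P]_w X3 w ^+ 2 ->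
  centered_gaussian [tuple X1; X2; X3].
Proof.
move=> G v1 v2 v3; have [n1 n2 n3] := gaussian3_components G.
have C (Q : {RV P >-> R} -> Prop) : Q X1 -> Q X2 -> Q X3 ->
    forall i, Q (tnth [tuple X1; X2; X3] i).
  move=> q1 q2 q3 i; case: (unliftP ord0 i) => [i1 ->|->]; rewrite (tnth_nth
    X1)//=.
  case: (unliftP ord0 i1) => [i2 ->|->] //=.
  by rewrite (ord1 i2).
split; first exact: gaussian3_jointly_gaussian.
- by apply: (C (fun X => 'E_P[X] = 0)%E); exact: centered_normal_mean0.
- have V (X : {RV P >-> R}) : centered_normal P X -> 0 < \int[P]_w X w ^+ 2 ->
      (0 < 'V_P[X])%E.
    move=> nX vX; rewrite variance_centered//.
    + exact: centered_normal_has_moments.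
    + exact: centered_normal_mean0.
  by apply: (C (fun X => 0 < 'V_P[X])%E); exact: V.
Qed.

End mutual_independence.

(** * The equivalence *)

Section decomposition.
Context {d : measure_display} {T : measurableType d} {R : realType}.
Variable P : probability T R.
Implicit Types (X U V : T -> R).

Lemma mean_sqr_ge0 X : 0 <= \int[P]_w X w ^+ 2.
Proof. by apply: Rintegral_ge0 => w _; exact: sqr_ge0. Qed.

(** The second moment of t U + X is affine in t when U has second moment 0; being nonnegative for
    all t, it has slope 0. *)
Lemma mean_mul_eq0 X U : has_moments P X -> has_moments P U ->
  \int[P]_w U w ^+ 2 = 0 -> \int[P]_w (X w * U w) = 0.
Proof.
move=> hX hU U0; set e := \int[P]_w _.
have h t := mean_sqr_ge0 (fun w => t * U w + X w).
have e' : \int[P]_w (U w * X w) = e.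
  by apply: eq_Rintegral => w _; rewrite mulrC.
have {}h t : 0 <= 2 * t * e + \int[P]_w X w ^+ 2.
  by have := h t; rewrite mean_sqr2// U0 mulr0 add0r e'.
apply/eqP/negPn/negP => e0.
(* The value of [t] for which the affine function equals -1. *)
have := h (- (\int[P]_w X w ^+ 2 + 1) / (2 * e)).
have -> : 2 * (- (\int[P]_w X w ^+ 2 + 1) / (2 * e)) * e =
    - (\int[P]_w X w ^+ 2 + 1) by field.
lra.
Qed.

Lemma gaussian3_gaussian2 X U V : gaussian3 P X U V -> gaussian2 P U V.
Proof.
by move=> G a b; have := G 0 a b; under eq_fun do rewrite mul0r add0r.
Qed.

Lemma standard_correlation_le1 U V : has_moments P U -> has_moments P V ->
  \int[P]_w U w ^+ 2 = 1 -> \int[P]_w V w ^+ 2 = 1 ->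
  (\int[P]_w (U w * V w)) ^+ 2 <= 1.
Proof.
move=> hU hV u1 v1; set r := \int[P]_w _.
have := mean_sqr_ge0 (fun w => - r * U w + V w).
rewrite mean_sqr2// u1 v1 -/r; nra.
Qed.

Lemma gaussian3_decomposition X U V : gaussian3 P X U V ->
  \int[P]_w U w ^+ 2 = 1 -> \int[P]_w V w ^+ 2 = 1 ->
  exists a b, gaussian3 P (fun w => X w - a * U w - b * V w) U V /\
    \int[P]_w ((X w - a * U w - b * V w) * U w) = 0 /\
    \int[P]_w ((X w - a * U w - b * V w) * V w) = 0.
Proof.
move=> G u1 v1; have [nX nU nV] := gaussian3_components G.
have hX := centered_normal_has_moments nX.
have hU := centered_normal_has_moments nU.
have hV := centered_normal_has_moments nV.
set r := \int[P]_w (U w * V w).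
have GZ a b : gaussian3 P (fun w => X w - a * U w - b * V w) U V.
  move=> x y z; have := G x (y - x * a) (z - x * b).
  by congr (centered_normal P _); apply/funext => w; ring.
have lin Y a b : has_moments P Y ->
    \int[P]_w ((X w - a * U w - b * V w) * Y w) =
    \int[P]_w (X w * Y w) - a * \int[P]_w (U w * Y w) - b * \int[P]_w (V w * Y
      w).
  move=> hY; have h1 := has_momentsM hX hY; have h2 := has_momentsM hU hY.
  have h3 := has_momentsM hV hY.
  transitivity (\int[P]_w (X w * Y w - a * (U w * Y w) - b * (V w * Y w))).
    by apply: eq_Rintegral => w _; ring.
  have h2' := has_momentsZ a h2; have h3' := has_momentsZ b h3.
  by rewrite !meanB ?meanZ//; exact: has_momentsB.
have UU : \int[P]_w (U w * U w) = 1.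
  by rewrite -u1; apply: eq_Rintegral => w _; rewrite expr2.
have VV : \int[P]_w (V w * V w) = 1.
  by rewrite -v1; apply: eq_Rintegral => w _; rewrite expr2.
have VU : \int[P]_w (V w * U w) = r.
  by apply: eq_Rintegral => w _; rewrite mulrC.
set x := \int[P]_w (X w * U w); set y := \int[P]_w (X w * V w).
(* The normal equations are singular here. Projecting on [U] alone is enough, since [V - r U] has
   second moment 0 and is thus orthogonal to [X]. *)
have [r1|r1] := eqVneq (r ^+ 2) 1.
  exists x; exists 0; split; first exact: GZ.
  rewrite !lin// -/x -/y -/r UU VV VU mulr1 !mul0r !subr0 subrr; split => //.
  have D0 : \int[P]_w (- r * U w + V w) ^+ 2 = 0.
    by rewrite mean_sqr2// u1 v1 -/r sqrrN r1; nra.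
  have hD : has_moments P (fun w => - r * U w + V w).
    by apply: has_momentsD => //; exact: has_momentsZ.
  have := mean_mul_eq0 hX hD D0.
  have -> : \int[P]_w (X w * (- r * U w + V w)) = - r * x + y.
    transitivity (\int[P]_w (- r * (X w * U w) + X w * V w)).
      by apply: eq_Rintegral => w _; ring.
    by rewrite meanD ?meanZ//; do ?[apply: has_momentsZ]; exact: has_momentsM.
  by move=> h; rewrite -[RHS]h; ring.
have r2 : 1 - r ^+ 2 != 0 by rewrite subr_eq0 eq_sym.
(* Cramer's rule for the normal equations a + r b = x, r a + b = y. *)
exists ((x - r * y) / (1 - r ^+ 2)); exists ((y - r * x) / (1 - r ^+ 2)).
split; first exact: GZ.
by rewrite !lin// -/x -/y -/r UU VV VU; split; field.
Qed.

Lemma uncorrelated_component_moment Z U V a b i k : gaussian3 P Z U V ->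
  \int[P]_w (Z w * U w) = 0 -> \int[P]_w (Z w * V w) = 0 ->
  \int[P]_w ((a * U w + b * V w + Z w) ^+ 2 * (U w ^+ i * V w ^+ k)) =
  a ^+ 2 * \int[P]_w (U w ^+ i.+2 * V w ^+ k)
  + 2 * a * b * \int[P]_w (U w ^+ i.+1 * V w ^+ k.+1)
  + b ^+ 2 * \int[P]_w (U w ^+ i * V w ^+ k.+2)
  + \int[P]_w Z w ^+ 2 * \int[P]_w (U w ^+ i * V w ^+ k).
Proof.
move=> G ZU ZV; have [nZ nU nV] := gaussian3_components G.
have hZ := centered_normal_has_moments nZ.
have hU := centered_normal_has_moments nU.
have hV := centered_normal_has_moments nV.
have hUV j l : has_moments P (fun w => U w ^+ j * V w ^+ l).
  by apply: has_momentsM; exact: has_momentsX.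
have [e1 _] := uncorrelated3_mean i.+1 k G ZU ZV.
have [e2 _] := uncorrelated3_mean i k.+1 G ZU ZV.
have [_ e3] := uncorrelated3_mean i k G ZU ZV.
rewrite -e3.
have h1 := has_momentsM hZ (hUV i.+1 k); have h2 := has_momentsM hZ (hUV i
  k.+1).
have h3 := has_momentsM (has_momentsX 2 hZ) (hUV i k).
transitivity (\int[P]_w (a ^+ 2 * (U w ^+ i.+2 * V w ^+ k)
  + 2 * a * b * (U w ^+ i.+1 * V w ^+ k.+1) + b ^+ 2 * (U w ^+ i * V w ^+ k.+2)
  + Z w ^+ 2 * (U w ^+ i * V w ^+ k)
  + 2 * a * (Z w * (U w ^+ i.+1 * V w ^+ k))
  + 2 * b * (Z w * (U w ^+ i * V w ^+ k.+1)))).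
  by apply: eq_Rintegral => w _; rewrite !exprS; ring.
rewrite !meanD//; do ?[exact: hUV|exact: has_momentsZ|apply: has_momentsD] =>
  //.
rewrite !meanZ// e1 e2; ring.
Qed.

End decomposition.

(** * Binary quadratic forms *)

Section equivalence.
Context {R : realType}.
Implicit Types A B C a b : R.

Lemma posdef_discriminant A B C :
  (forall a b, (a != 0) || (b != 0) ->
    0 < A * a ^+ 2 + 2 * B * (a * b) + C * b ^+ 2) -> B ^+ 2 < A * C.
Proof.
move=> H; have A0 : 0 < A.
  by have := H 1 0; rewrite oner_eq0 => /(_ isT); lra.
(* For fixed [b = A] the form is least at [a = - B], where its value is [A] times the
   determinant. *)
have := H (- B) A; rewrite (gt_eqF A0) orbT => /(_ isT).
have -> : A * (- B) ^+ 2 + 2 * B * (- B * A) + C * A ^+ 2 = A * (A * C - B ^+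
  2).
  by ring.
by rewrite pmulr_rgt0// subr_gt0.
Qed.

Lemma quadratic_form_ge0 A B C a b : 0 < A -> B ^+ 2 <= A * C ->
  0 <= A * a ^+ 2 + 2 * B * (a * b) + C * b ^+ 2.
Proof.
move=> A0 BAC; rewrite -(pmulr_rge0 _ A0).
have -> : A * (A * a ^+ 2 + 2 * B * (a * b) + C * b ^+ 2) =
  (A * a + B * b) ^+ 2 + (A * C - B ^+ 2) * b ^+ 2 by ring.
by rewrite addr_ge0 ?sqr_ge0// mulr_ge0 ?sqr_ge0// subr_ge0.
Qed.

Lemma quadratic_form_eq0 A B C a b : 0 < A -> B ^+ 2 < A * C ->
  A * a ^+ 2 + 2 * B * (a * b) + C * b ^+ 2 = 0 -> a = 0 /\ b = 0.
Proof.
move=> A0 BAC Q0.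
have : (A * a + B * b) ^+ 2 + (A * C - B ^+ 2) * b ^+ 2 = 0.
  by rewrite -[RHS](mulr0 A) -Q0; ring.
have disc0 : 0 < A * C - B ^+ 2 by rewrite subr_gt0.
move/eqP; rewrite paddr_eq0 ?sqr_ge0//; last by rewrite mulr_ge0 ?sqr_ge0// ltW.
rewrite sqrf_eq0 (mulf_eq0 (_ - _)) (gt_eqF disc0) sqrf_eq0 /= => /andP[/eqP h
  /eqP b0].
split => //; move: h; rewrite b0 mulr0 addr0 => /eqP.
by rewrite mulf_eq0 (gt_eqF A0) /= => /eqP.
Qed.

Lemma standard_moment_uncorrelated d (T : measurableType d)
    (P : probability T R) (U V : T -> R) m n : gaussian2 P U V ->
  \int[P]_w U w ^+ 2 = 1 -> \int[P]_w V w ^+ 2 = 1 ->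
  \int[P]_w (U w * V w) = 0 ->
  \int[P]_w (U w ^+ (2 * m) * V w ^+ (2 * n)) =
  (odd_dfact m)%:R * (odd_dfact n)%:R.
Proof.
move=> G u1 v1 r0.
have mn : (2 * m + 2 * n = 2 * (m + n))%N by rewrite mulnDr.
have := gaussian2_coef G mn; rewrite u1 v1 r0 mulr0 scale0r addr0 coef_exp_even.
have -> : ((2 * m)./2 = m)%N by rewrite mul2n doubleK.
rewrite oddM /= !expr1n mul1r => h.
have c0 : 'C(2 * (m + n), 2 * m)%:R != 0 :> R.
  by rewrite pnatr_eq0 -lt0n bin_gt0 leq_mul2l leq_addr.
apply: (mulfI c0); rewrite h -!natrM -odd_dfact_bin natrM; ring.
Qed.

(** With the raw moments [A0], [B0], [C0], the gap in assertion (2) is exactly the determinant of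
    the quadratic form of excesses. *)
Lemma moment_inequality_scalar (A0 B0 C0 D r : R) :
  C0 * A0 + D * (2 * B0 * r + D * (1 - r ^+ 2))
  - (B0 ^+ 2 + D * (C0 + A0)) = (A0 - D) * (C0 - D) - (B0 - r * D) ^+ 2.
Proof. by ring. Qed.

End equivalence.

(** * The quadratic form attached to a standard pair *)

Section standard_pair.
Context {d : measure_display} {T : measurableType d} {R : realType}.
Variables (P : probability T R) (U V : T -> R) (m2 m3 : nat).
Hypotheses (G : gaussian2 P U V) (u1 : \int[P]_w U w ^+ 2 = 1)
  (v1 : \int[P]_w V w ^+ 2 = 1) (hm2 : (0 < m2)%N) (hm3 : (0 < m3)%N).
Local Notation M j k := (\int[P]_w (U w ^+ j * V w ^+ k)).
Local Notation r := (\int[P]_w (U w * V w)).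
Local Notation D := ((odd_dfact m2)%:R * (odd_dfact m3)%:R : R).

(** The moment bound at [m2.+1] has the extra factor 2 m2 + 1, which exceeds 1. *)
Lemma standard_excess_gt0 : 0 < M (2 * m2).+2 (2 * m3) - D.
Proof.
have [h _] := standard_moment_ge G u1 v1 (ltn0Sn m2) hm3.
rewrite subr_gt0; apply: lt_le_trans (le_trans h _); last first.
  by rewrite mulnS.
rewrite ltr_pM2r ?ltr0n ?odd_dfact_gt0// ltr_nat odd_dfactS.
by rewrite -[ltnLHS]muln1 ltn_pmul2l ?odd_dfact_gt0//; lia.
Qed.

(** Moments of total degree 2 (m2 + m3 + 1) share one double factorial and differ by a power of r
    only, whose parity decides. *)
Lemma standard_collinear_excess : r ^+ 2 = 1 ->
  M (2 * m2) (2 * m3).+2 = M (2 * m2).+2 (2 * m3) /\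
  M (2 * m2).+1 (2 * m3).+1 = r * M (2 * m2).+2 (2 * m3).
Proof.
move=> r1; have K i k (ik : (i + k = 2 * (m2 + m3).+1)%N) :=
  standard_moment_collinear G u1 v1 r1 ik.
rewrite !K; [|lia..]; rewrite exprS exprS mulnC exprM exprAC r1 expr1n.
by rewrite mulr1 -expr2 r1; split; ring.
Qed.

Local Notation pair_le := ((M (2 * m2).+1 (2 * m3).+1 - r * D) ^+ 2 <=
  (M (2 * m2).+2 (2 * m3) - D) * (M (2 * m2) (2 * m3).+2 - D)).
Local Notation pair_eq := ((M (2 * m2).+1 (2 * m3).+1 - r * D) ^+ 2 =
  (M (2 * m2).+2 (2 * m3) - D) * (M (2 * m2) (2 * m3).+2 - D)).

(** The hypothesis is assertion (1) for the triples with first component a U + b V, its equality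
    clause being used through the vanishing of correlations. *)
Lemma pair_of_triple :
  (forall a b, 0 < \int[P]_w (a * U w + b * V w) ^+ 2 ->
    let I := \int[P]_w ((a * U w + b * V w) ^+ 2
      * (U w ^+ (2 * m2) * V w ^+ (2 * m3))) in
    D * \int[P]_w (a * U w + b * V w) ^+ 2 <= I /\
    (I = D * \int[P]_w (a * U w + b * V w) ^+ 2 ->
      \int[P]_w ((a * U w + b * V w) * U w) = 0 /\
      \int[P]_w ((a * U w + b * V w) * V w) = 0)) ->
  pair_le /\ (pair_eq <-> r ^+ 2 = 1).
Proof.
move=> H; have [hU hV] := gaussian2_has_moments G.
have rle1 := standard_correlation_le1 hU hV u1 v1.
have [r1|rn1] := eqVneq (r ^+ 2) 1.
  have [-> ->] := standard_collinear_excess r1.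
  set A := M _ _.
  have -> : (r * A - r * D) ^+ 2 = r ^+ 2 * ((A - D) * (A - D)) by ring.
  by rewrite r1 mul1r.
have rlt1 : r ^+ 2 < 1 by rewrite lt_def eq_sym rn1 rle1.
have hM j k : has_moments P (fun w => U w ^+ j * V w ^+ k).
  by apply: has_momentsM; exact: has_momentsX.
have IE a b : \int[P]_w ((a * U w + b * V w) ^+ 2
    * (U w ^+ (2 * m2) * V w ^+ (2 * m3))) =
    a ^+ 2 * M (2 * m2).+2 (2 * m3) + 2 * a * b * M (2 * m2).+1 (2 * m3).+1
    + b ^+ 2 * M (2 * m2) (2 * m3).+2.
  transitivity (\int[P]_w (a ^+ 2 * (U w ^+ (2 * m2).+2 * V w ^+ (2 * m3))
      + 2 * a * b * (U w ^+ (2 * m2).+1 * V w ^+ (2 * m3).+1)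
      + b ^+ 2 * (U w ^+ (2 * m2) * V w ^+ (2 * m3).+2))).
    by apply: eq_Rintegral => w _; rewrite !exprS; ring.
  have hZ c j k := has_momentsZ c (hM j k).
  by rewrite !meanD ?meanZ//; exact: has_momentsD.
have X2E a b : \int[P]_w (a * U w + b * V w) ^+ 2 =
    a ^+ 2 + 2 * a * b * r + b ^+ 2.
  transitivity (\int[P]_w (a * U w + b * V w + 0 * V w) ^+ 2).
    by apply: eq_Rintegral => w _; rewrite mul0r addr0.
  by rewrite mean_sqr3// u1 v1; ring.
suff lt_pair : (M (2 * m2).+1 (2 * m3).+1 - r * D) ^+ 2 <
    (M (2 * m2).+2 (2 * m3) - D) * (M (2 * m2) (2 * m3).+2 - D).
  split; first exact: ltW.
  by split => h; [rewrite h ltxx in lt_pair|rewrite h eqxx in rn1].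
apply: posdef_discriminant => a b ab.
have X0 : 0 < a ^+ 2 + 2 * a * b * r + b ^+ 2.
  have -> : a ^+ 2 + 2 * a * b * r + b ^+ 2 =
      (a + r * b) ^+ 2 + (1 - r ^+ 2) * b ^+ 2 by ring.
  have [b0|b0] := eqVneq b 0.
    by rewrite b0 !mulr0 addr0 expr0n mulr0 addr0 exprn_even_gt0//=;
      move: ab; rewrite b0 eqxx orbF.
  by rewrite ltr_wpDl ?sqr_ge0// mulr_gt0 ?subr_gt0// exprn_even_gt0.
have [] := H a b; first by rewrite X2E.
(* Equality would make a U + b V orthogonal to U and V, hence to itself, against its positive
   variance. *)
rewrite le_eqVlt => /predU1P[e|lt_I] eq_I.
  have [h1 h2] := eq_I (esym e).
  have hW : has_moments P (fun w => a * U w + b * V w).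
    by apply: has_momentsD; exact: has_momentsZ.
  have : \int[P]_w (a * U w + b * V w) ^+ 2 = 0.
    transitivity (\int[P]_w (a * ((a * U w + b * V w) * U w)
        + b * ((a * U w + b * V w) * V w))).
      by apply: eq_Rintegral => w _; ring.
    have hWU := has_momentsM hW hU; have hWV := has_momentsM hW hV.
    by rewrite meanD ?meanZ ?h1 ?h2 ?mulr0 ?addr0//; exact: has_momentsZ.
  by rewrite X2E => X00; rewrite X00 ltxx in X0.
by move: lt_I; rewrite IE X2E -subr_gt0; congr (0 < _); ring.
Qed.

Lemma triple_of_pair X : gaussian3 P X U V -> 0 < \int[P]_w X w ^+ 2 ->
  pair_le -> (pair_eq -> r ^+ 2 = 1) ->
  let I := \int[P]_w (X w ^+ 2 * (U w ^+ (2 * m2) * V w ^+ (2 * m3))) in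
  D * \int[P]_w X w ^+ 2 <= I /\
  (I = D * \int[P]_w X w ^+ 2 <->
    [/\ \int[P]_w (X w * U w) = 0, \int[P]_w (X w * V w) = 0 & r = 0]).
Proof.
move=> G3 X0 le_pair eq_pair I.
have [nX nU nV] := gaussian3_components G3.
have hX := centered_normal_has_moments nX.
have hU := centered_normal_has_moments nU.
have hV := centered_normal_has_moments nV.
have [a [b [GZ [ZU ZV]]]] := gaussian3_decomposition G3 u1 v1.
have [nZ _ _] := gaussian3_components GZ.
have hZ := centered_normal_has_moments nZ.
set Z := fun w => X w - a * U w - b * V w in GZ ZU ZV nZ hZ.
set v := \int[P]_w Z w ^+ 2.
have XE w : X w = a * U w + b * V w + Z w by rewrite /Z; ring.
have UZ : \int[P]_w (U w * Z w) = 0.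
  by rewrite -[RHS]ZU; apply: eq_Rintegral => w _; rewrite mulrC.
have VZ : \int[P]_w (V w * Z w) = 0.
  by rewrite -[RHS]ZV; apply: eq_Rintegral => w _; rewrite mulrC.
have X2E : \int[P]_w X w ^+ 2 = a ^+ 2 + 2 * a * b * r + b ^+ 2 + v.
  transitivity (\int[P]_w (a * U w + b * V w + 1 * Z w) ^+ 2).
    by apply: eq_Rintegral => w _; rewrite XE mul1r.
  by rewrite mean_sqr3// u1 v1 UZ VZ -/v; ring.
have IE := uncorrelated_component_moment a b (2 * m2) (2 * m3) GZ ZU ZV.
have {}IE : I = a ^+ 2 * M (2 * m2).+2 (2 * m3)
    + 2 * a * b * M (2 * m2).+1 (2 * m3).+1 + b ^+ 2 * M (2 * m2) (2 * m3).+2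
    + v * M (2 * m2) (2 * m3).
  by rewrite -[RHS]IE; apply: eq_Rintegral => w _; rewrite -XE.
have [ge0 gt0] := standard_moment_ge G u1 v1 hm2 hm3.
have A0 := standard_excess_gt0.
have col := standard_collinear_excess.
move: le_pair eq_pair A0 col IE ge0 gt0.
set A := M _.+2 _; set B := M _.+1 _; set C := M _ _.+2; set F := M _ _.
set K := D => le_pair eq_pair A0 col IE ge0 gt0.
have v0 : 0 <= v := mean_sqr_ge0 P Z.
have diff : I - K * \int[P]_w X w ^+ 2 =
    ((A - K) * a ^+ 2 + 2 * (B - r * K) * (a * b) + (C - K) * b ^+ 2)
    + v * (F - K).
  by rewrite IE X2E; ring.
have Q0 := quadratic_form_ge0 a b A0 le_pair.
have vF : 0 <= v * (F - K) by rewrite mulr_ge0// subr_ge0.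
split; first by rewrite -subr_ge0 diff addr_ge0.
split; last first.
  move=> [XU XV UV].
  have [_ e] := uncorrelated3_mean (2 * m2) (2 * m3) G3 XU XV.
  by rewrite /I e (standard_moment_uncorrelated m2 m3 G u1 v1 UV) mulrC.
(* Equality makes both nonnegative summands vanish: the quadratic form and [v * (F - K)]. *)
move=> e; move/eqP: diff; rewrite e subrr eq_sym paddr_eq0// => /andP[/eqP Qe
  /eqP vFe].
have [r1|r1] := eqVneq (r ^+ 2) 1.
  have [CA BA] := col r1.
  have Fv : v = 0.
    have rn0 : r != 0 by apply/eqP => r0; move: r1; rewrite r0 expr0n/=; lra.
    move/eqP: vFe; rewrite mulf_eq0 subr_eq0 (gt_eqF (gt0 rn0)) orbF.
    by move/eqP.
  have : (A - K) * (a ^+ 2 + 2 * a * b * r + b ^+ 2) = 0.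
    by rewrite -[RHS]Qe CA BA; ring.
  move/eqP; rewrite mulf_eq0 (gt_eqF A0) /= => /eqP h.
  by move: X0; rewrite X2E h Fv addr0 ltxx.
have lt_pair : (B - r * K) ^+ 2 < (A - K) * (C - K).
  rewrite lt_def le_pair andbT; apply: contra_neq r1 => h.
  by apply: eq_pair; rewrite h.
(* Now X1 is its own residual Z, so [v] is positive and [F = K], which is possible only if r = 0. *)
have [a0 b0] := quadratic_form_eq0 A0 lt_pair Qe.
have vp : v != 0.
  by apply: contraTneq X0 => vz; rewrite X2E a0 b0 vz; rewrite -leNgt; lra.
have r0 : r = 0.
  apply/eqP/negPn/negP => /gt0 FK.
  by move/eqP: vFe; rewrite mulf_eq0 (negbTE vp) subr_eq0 (gt_eqF FK).
split => //.
- rewrite -[RHS]ZU; apply: eq_Rintegral => w _.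
  by rewrite /Z a0 b0 !mul0r !subr0.
- rewrite -[RHS]ZV; apply: eq_Rintegral => w _.
  by rewrite /Z a0 b0 !mul0r !subr0.
Qed.

End standard_pair.

(** * From the reduced inequalities to the two assertions *)

Section bridge.
Context {d : measure_display} {T : measurableType d} {R : realType}.
Variable P : probability T R.

Lemma standard_normal_mean_variance (U : {RV P >-> R}) : is_normal P 0 1 U ->
  ('E_P[U] = 0)%E /\ \int[P]_w U w ^+ 2 = 1.
Proof.
move=> nU; have mU : measurable_fun setT U by exact: measurable_funP.
split; last by rewrite (centered_normal_variance mU nU) expr1n.
by rewrite expectation_mean ?(is_normal_mean mU nU)//; exact:
  is_normal_has_moments nU.
Qed.

Lemma centered_normal_standard (X : T -> R) : centered_normal P X ->
  \int[P]_w X w ^+ 2 = 1 -> is_normal P 0 1 X.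
Proof.
move=> [mX [s s0 nX]]; rewrite (centered_normal_variance mX nX) => s1.
suff -> : 1 = s by [].
by apply/eqP; rewrite eq_sym -(@eqrXn2 _ 2)// s1 expr1n.
Qed.

Lemma independent3_uncorrelated (X1 X2 X3 : {RV P >-> R}) :
  gaussian3 P X1 X2 X3 -> mutually_independent [tuple X1; X2; X3] ->
  [/\ \int[P]_w (X1 w * X2 w) = 0, \int[P]_w (X1 w * X3 w) = 0
    & \int[P]_w (X2 w * X3 w) = 0].
Proof.
move=> G ind; have [n1 n2 n3] := gaussian3_components G.
have h1 := centered_normal_has_moments n1.
have h2 := centered_normal_has_moments n2.
have h3 := centered_normal_has_moments n3.
have z (X : T -> R) : centered_normal P X -> \int[P]_w X w = 0.
  by move=> [mX [s _ nX]]; exact: is_normal_mean mX nX.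
pose i0 : 'I_3 := ord0; pose i1 : 'I_3 := lift ord0 ord0.
pose i2 : 'I_3 := lift ord0 (lift ord0 ord0).
split.
- have := @mutually_independent_uncorrelated _ _ _ _ _ _ i0 i1 isT ind.
  by rewrite !(tnth_nth X1) /= (z _ n1) mul0r; apply.
- have := @mutually_independent_uncorrelated _ _ _ _ _ _ i0 i2 isT ind.
  by rewrite !(tnth_nth X1) /= (z _ n1) mul0r; apply.
- have := @mutually_independent_uncorrelated _ _ _ _ _ _ i1 i2 isT ind.
  by rewrite !(tnth_nth X1) /= (z _ n2) mul0r; apply.
Qed.

Definition rv_of (X : T -> R) (mX : measurable_fun setT X) : {mfun T >-> R} :=
  HB.pack X (isMeasurableFun.Build _ _ _ _ X mX).

Lemma standardize (X : T -> R) : 0 < \int[P]_w X w ^+ 2 ->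
  exists2 s : R, s != 0 & s ^+ 2 * \int[P]_w X w ^+ 2 = 1.
Proof.
move=> X0; exists (Num.sqrt (\int[P]_w X w ^+ 2))^-1.
  by rewrite invr_eq0 gt_eqF// sqrtr_gt0.
by rewrite exprVn sqr_sqrtr ?ltW// mulVf// gt_eqF.
Qed.

(** Only X2 and X3 are rescaled: both sides then carry the same factor [c], and vanishing
    correlations are unaffected. Independence and zero correlations are interchangeable for the
    Gaussian triple. *)
Lemma triple_of_standard_pair (X1 X2 X3 : {RV P >-> R}) m2 m3 :
  (0 < m2)%N -> (0 < m3)%N -> gaussian3 P X1 X2 X3 ->
  0 < \int[P]_w X1 w ^+ 2 -> 0 < \int[P]_w X2 w ^+ 2 ->
  0 < \int[P]_w X3 w ^+ 2 ->
  (forall U V : {RV P >-> R}, gaussian2 P U V ->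
    \int[P]_w U w ^+ 2 = 1 -> \int[P]_w V w ^+ 2 = 1 ->
    let M j k := \int[P]_w (U w ^+ j * V w ^+ k) in
    let r := \int[P]_w (U w * V w) in
    let K := (odd_dfact m2)%:R * (odd_dfact m3)%:R in
    let B2 := (M (2 * m2).+1 (2 * m3).+1 - r * K) ^+ 2 in
    let AC := (M (2 * m2).+2 (2 * m3) - K) * (M (2 * m2) (2 * m3).+2 - K) in
    B2 <= AC /\ (B2 = AC <-> r ^+ 2 = 1)) ->
  let I := \int[P]_w (X1 w ^+ 2 * (X2 w ^+ (2 * m2) * X3 w ^+ (2 * m3))) in
  let J := (odd_dfact m2)%:R * (odd_dfact m3)%:R * \int[P]_w X1 w ^+ 2 *
    ((\int[P]_w X2 w ^+ 2) ^+ m2 * (\int[P]_w X3 w ^+ 2) ^+ m3) in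
  J <= I /\ (I = J <-> mutually_independent [tuple X1; X2; X3]).
Proof.
move=> hm2 hm3 G q1 q2 q3 H I J; have [n1 n2 n3] := gaussian3_components G.
have h1 := centered_normal_has_moments n1.
have h2 := centered_normal_has_moments n2.
have h3 := centered_normal_has_moments n3.
have [s s0 sE] := standardize q2; have [t t0 tE] := standardize q3.
have hU := has_momentsZ s h2; have hV := has_momentsZ t h3.
pose U : {RV P >-> R} := rv_of hU.1; pose V : {RV P >-> R} := rv_of hV.1.
have G3 : gaussian3 P X1 U V.
  move=> x y z; have := G x (y * s) (z * t).
  by congr (centered_normal P _); apply/funext => w /=; ring.
have sqrZ k (X : T -> R) : has_moments P X ->
    \int[P]_w (k * X w) ^+ 2 = k ^+ 2 * \int[P]_w X w ^+ 2.
  move=> hX; rewrite -meanZ; last exact: has_momentsX.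
  by apply: eq_Rintegral => w _; rewrite exprMn.
have u1 : \int[P]_w U w ^+ 2 = 1 by rewrite sqrZ.
have v1 : \int[P]_w V w ^+ 2 = 1 by rewrite sqrZ.
have [le_pair eq_pair] := H U V (gaussian3_gaussian2 G3) u1 v1.
have [le_I eq_I] := triple_of_pair (gaussian3_gaussian2 G3) u1 v1 hm2 hm3 G3 q1
  le_pair (eq_pair.1).
rewrite {}/J.
set D := (odd_dfact m2)%:R * (odd_dfact m3)%:R in le_I eq_I *.
set I' := \int[P]_w (X1 w ^+ 2 * (U w ^+ (2 * m2) * V w ^+ (2 * m3))) in le_I
  eq_I.
set c := (\int[P]_w X2 w ^+ 2) ^+ m2 * (\int[P]_w X3 w ^+ 2) ^+ m3.
have c0 : 0 < c by rewrite mulr_gt0// exprn_gt0.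
have I'E : I = I' * c.
  have e : I' = s ^+ (2 * m2) * t ^+ (2 * m3) * I.
    rewrite -meanZ.
      by apply: eq_Rintegral => w _; rewrite /= !exprMn; ring.
    apply: has_momentsM; first exact: has_momentsX.
    by apply: has_momentsM; exact: has_momentsX.
  rewrite e !exprM /c mulrAC mulrACA -!exprMn sE tE !expr1n; ring.
have mul0 (k : R) (Y Z : T -> R) : k != 0 -> has_moments P Y -> has_moments P Z
  ->
    (\int[P]_w (Y w * (k * Z w)) = 0) <-> (\int[P]_w (Y w * Z w) = 0).
  move=> k0 hY hZ; have -> : \int[P]_w (Y w * (k * Z w)) = k * \int[P]_w (Y w *
    Z w).
    rewrite -meanZ; last exact: has_momentsM.
    by apply: eq_Rintegral => w _; rewrite mulrCA.
  by split => [/eqP|->]; rewrite ?mulr0// mulf_eq0 (negbTE k0) /= => /eqP.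
have e12 := mul0 s X1 X2 s0 h1 h2; have e13 := mul0 t X1 X3 t0 h1 h3.
have e23 : (\int[P]_w (U w * V w) = 0) <-> (\int[P]_w (X2 w * X3 w) = 0).
  have c1 : \int[P]_w (U w * X3 w) = \int[P]_w (X3 w * (s * X2 w)).
    by apply: eq_Rintegral => w _; rewrite mulrC.
  have c2 : \int[P]_w (X2 w * X3 w) = \int[P]_w (X3 w * X2 w).
    by apply: eq_Rintegral => w _; rewrite mulrC.
  rewrite c2; apply: iff_trans (mul0 s X3 X2 s0 h3 h2); rewrite -c1.
  exact: mul0 t0 hU h3.
split; first by rewrite I'E ler_pM2r.
have -> : I = D * \int[P]_w X1 w ^+ 2 * c <-> I' = D * \int[P]_w X1 w ^+ 2.
  rewrite I'E; split => [/(mulIf (lt0r_neq0 c0))//|->//].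
rewrite eq_I; split => [[/e12 c12 /e13 c13 /e23 c23]|ind].
  exact: uncorrelated_mutually_independent.
have [c12 c13 c23] := independent3_uncorrelated G ind.
by split; [exact/e12|exact/e13|exact/e23].
Qed.

Lemma pair_statementE (U V : {RV P >-> R}) m2 m3 : gaussian2 P U V ->
  \int[P]_w U w ^+ 2 = 1 -> \int[P]_w V w ^+ 2 = 1 ->
  let E (j k : nat) : \bar R := ('E_P[fun w => (U w ^+ j * V w ^+ k)%R])%E in
  let D : \bar R := ((odd_dfact m2)%:R * (odd_dfact m3)%:R)%:E in
  let lhs := (E (2 * m2 + 1)%N (2 * m3 + 1)%N ^+ 2
    + D * (E (2 * m2)%N (2 * m3 + 2)%N + E (2 * m3)%N (2 * m2 + 2)%N))%E in
  let rhs := (E (2 * m2)%N (2 * m3 + 2)%N * E (2 * m3)%N (2 * m2 + 2)%N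
    + D * (2%:E * E (2 * m2 + 1)%N (2 * m3 + 1)%N * E 1%N 1%N
             + D * (1 - E 1%N 1%N ^+ 2)))%E in
  let M j k := \int[P]_w (U w ^+ j * V w ^+ k) in
  let r := \int[P]_w (U w * V w) in
  let K := (odd_dfact m2)%:R * (odd_dfact m3)%:R in
  let B2 := (M (2 * m2).+1 (2 * m3).+1 - r * K) ^+ 2 in
  let AC := (M (2 * m2).+2 (2 * m3) - K) * (M (2 * m2) (2 * m3).+2 - K) in
  [/\ (lhs <= rhs)%E = (B2 <= AC), lhs = rhs <-> B2 = AC
    & (`|E 1%N 1%N| = 1)%E <-> r ^+ 2 = 1].
Proof.
move=> G u1 v1 E D lhs rhs M r K B2 AC.
have [hU hV] := gaussian2_has_moments G.
have hE j k : E j k = (M j k)%:E.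
  by apply: expectation_mean; apply: has_momentsM; exact: has_momentsX.
have rE : M 1%N 1%N = r by [].
have sym : M (2 * m3)%N (2 * m2).+2 = M (2 * m2).+2 (2 * m3)%N.
  exact: standard_moment_sym.
have lhsE : lhs = (M (2 * m2).+1 (2 * m3).+1 ^+ 2
    + K * (M (2 * m2)%N (2 * m3).+2 + M (2 * m2).+2 (2 * m3)%N))%:E.
  by rewrite /lhs !addn1 !addn2 !hE sym -EFin_expe.
have rhsE : rhs = (M (2 * m2)%N (2 * m3).+2 * M (2 * m2).+2 (2 * m3)%N
    + K * (2 * M (2 * m2).+1 (2 * m3).+1 * r + K * (1 - r ^+ 2)))%:E.
  by rewrite /rhs !addn1 !addn2 !hE sym rE -EFin_expe.
have diff := moment_inequality_scalar (M (2 * m2).+2 (2 * m3)%N)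
  (M (2 * m2).+1 (2 * m3).+1) (M (2 * m2)%N (2 * m3).+2) K r.
rewrite lhsE rhsE; split.
- by rewrite lee_fin -subr_ge0 diff subr_ge0.
- split => [[/esym/eqP]|/esym/eqP h].
    by rewrite -subr_eq0 diff subr_eq0 => /eqP.
  by congr EFin; apply/esym/eqP; rewrite -subr_eq0 diff subr_eq0.
- rewrite hE rE /= -[r ^+ 2]real_normK ?num_real//; split => [[->]|/eqP].
    by rewrite expr1n.
  rewrite sqrf_eq1 => /orP[/eqP -> //|/eqP h].
  by move: (normr_ge0 r); rewrite h oppr_ge0 ler10.
Qed.

Lemma triple_statementE (X1 X2 X3 : {RV P >-> R}) m2 m3 :
  gaussian3 P X1 X2 X3 ->
  let lhs := ('E_P[fun w => (X1 w ^+ 2 * X2 w ^+ (2 * m2) * X3 w ^+ (2 *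
    m3))%R])%E in
  let rhs := ('E_P[fun w => (X1 w ^+ 2)%R] * 'E_P[fun w => (X2 w ^+ (2 * m2))%R]
      * 'E_P[fun w => (X3 w ^+ (2 * m3))%R])%E in
  let I := \int[P]_w (X1 w ^+ 2 * (X2 w ^+ (2 * m2) * X3 w ^+ (2 * m3))) in
  let J := (odd_dfact m2)%:R * (odd_dfact m3)%:R * \int[P]_w X1 w ^+ 2 *
    ((\int[P]_w X2 w ^+ 2) ^+ m2 * (\int[P]_w X3 w ^+ 2) ^+ m3) in
  (rhs <= lhs)%E = (J <= I) /\ (lhs = rhs <-> I = J).
Proof.
move=> G lhs rhs I J; have [n1 n2 n3] := gaussian3_components G.
have h1 := centered_normal_has_moments n1.
have h2 := centered_normal_has_moments n2.
have h3 := centered_normal_has_moments n3.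
have hX n (X : T -> R) (hX : has_moments P X) := has_momentsX n hX.
have lhsE : lhs = I%:E.
  rewrite /lhs expectation_mean; last first.
    by do 2 ?apply: has_momentsM; exact: hX.
  by congr EFin; apply: eq_Rintegral => w _; rewrite mulrA.
have rhsE : rhs = J%:E.
  rewrite /rhs !expectation_mean; do ?exact: hX.
  by rewrite !centered_normal_even_moment// -!EFinM; congr EFin; rewrite /J;
    ring.
by rewrite lhsE rhsE lee_fin; split => //; split => [[]|->].
Qed.

End bridge.

Local Close Scope ring_scope.
Local Close Scope classical_set_scope.
Local Open Scope ereal_scope.

Theorem lemma4p1 (R : realType) (m2 m3 : nat)
    (hm2 : (0 < m2)%N) (hm3 : (0 < m3)%N) :
  (forall (d : measure_display) (T : measurableType d) (P : probability T R)
      (X1 X2 X3 : {RV P >-> R}),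
    centered_gaussian [tuple X1; X2; X3] ->
    let lhs : \bar R :=
      'E_P[fun w => (X1 w ^+ 2 * X2 w ^+ (2 * m2) * X3 w ^+ (2 * m3))%R] in
    let rhs : \bar R :=
      'E_P[fun w => (X1 w ^+ 2)%R] * 'E_P[fun w => (X2 w ^+ (2 * m2))%R]
      * 'E_P[fun w => (X3 w ^+ (2 * m3))%R] in
    rhs <= lhs /\ (lhs = rhs <-> mutually_independent [tuple X1; X2; X3]))
  <->
  (forall (d : measure_display) (T : measurableType d) (P : probability T R)
      (U V : {RV P >-> R}),
    jointly_gaussian [tuple U; V] ->
    is_normal P 0 1 U ->
    is_normal P 0 1 V ->
    let E (j k : nat) : \bar R := 'E_P[fun w => (U w ^+ j * V w ^+ k)%R] in
    let D : \bar R := ((odd_dfact m2)%:R * (odd_dfact m3)%:R)%:E in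
    let lhs : \bar R :=
      E (2 * m2 + 1)%N (2 * m3 + 1)%N ^+ 2
      + D * (E (2 * m2)%N (2 * m3 + 2)%N + E (2 * m3)%N (2 * m2 + 2)%N) in
    let rhs : \bar R :=
      E (2 * m2)%N (2 * m3 + 2)%N * E (2 * m3)%N (2 * m2 + 2)%N
      + D * (2%:E * E (2 * m2 + 1)%N (2 * m3 + 1)%N * E 1%N 1%N
             + D * (1 - E 1%N 1%N ^+ 2)) in
    lhs <= rhs /\ (lhs = rhs <-> `|E 1%N 1%N| = 1)).
Proof.
split.
- move=> H1 d T P U V JG nU nV E D lhs rhs.
  have [EU u1] := standard_normal_mean_variance nU; have [EV v1] :=
    standard_normal_mean_variance nV.
  have G := jointly_gaussian2 JG EU EV.
  have [leE eqE normE] := pair_statementE m2 m3 G u1 v1.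
  have mU : measurable_fun setT U by exact: measurable_funP.
  have mV : measurable_fun setT V by exact: measurable_funP.
  rewrite /lhs /rhs leE eqE normE.
  apply: pair_of_triple => // a b vX I.
  (* The triple built on the pair itself; its covariance matrix is singular, which assertion (1)
     allows. *)
  have [mX _] := G a b; pose X : {RV P >-> R} := rv_of mX.
  have G3 : gaussian3 P X U V.
    move=> x y z; have := G (x * a + y)%R (x * b + z)%R.
    by congr (centered_normal P _); apply/funext => w /=; ring.
  have CG : centered_gaussian [tuple X; U; V].
    by apply: gaussian3_centered_gaussian => //; rewrite ?u1 ?v1.
  have [le_I eq_I] := H1 _ _ _ _ _ _ CG.
  have [leE' eqE'] := triple_statementE m2 m3 G3.
  rewrite leE' u1 v1 !expr1n !mulr1 in le_I; split; first exact: le_I.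
  rewrite u1 v1 !expr1n !mulr1 in eqE'.
  move=> IE; have [] := independent3_uncorrelated G3.
    by apply/eq_I/eqE'.
  by [].
- move=> H2 d T P X1 X2 X3 CG lhs rhs.
  have G := centered_gaussian3 CG.
  have [n1 n2 n3] := gaussian3_components G.
  have h1 := centered_normal_has_moments n1.
  have h2 := centered_normal_has_moments n2.
  have h3 := centered_normal_has_moments n3.
  have [leE eqE] := triple_statementE m2 m3 G.
  rewrite /lhs /rhs leE eqE {leE eqE lhs rhs}.
  have var (X : {RV P >-> R}) : centered_normal P X -> (0 < 'V_P[X])%E ->
      (0 < \int[P]_w X w ^+ 2)%R.
    move=> nX; rewrite variance_centered ?lte_fin//.
      exact: centered_normal_has_moments.
    exact: centered_normal_mean0.
  have [_ _ V0] := CG.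
  have q1 := var _ n1 (V0 ord0).
  have q2 := var _ n2 (V0 (lift ord0 ord0)).
  have q3 := var _ n3 (V0 (lift ord0 (lift ord0 ord0))).
  (* What remains is assertion (2) on the given probability space, with laws expressed by second
     moments. *)
  apply: triple_of_standard_pair => // U V GUV u1 v1.
  have [nU nV] : centered_normal P U /\ centered_normal P V.
    split.
      by have := GUV 1%R 0%R; under eq_fun do rewrite mul0r addr0 mul1r.
    by have := GUV 0%R 1%R; under eq_fun do rewrite mul0r add0r mul1r.
  have := H2 _ _ _ _ _ (gaussian2_jointly_gaussian GUV)
    (centered_normal_standard nU u1) (centered_normal_standard nV v1).
  have [leE eqE normE] := pair_statementE m2 m3 GUV u1 v1.
  by rewrite /= leE eqE normE.
Qed.
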